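(* Uniformly in $k\ge1$ we have, as $n\to+\infty$, $$q_{n,\infty,1/2}(k)=u_{\lambda_n,1/2}(k)+O\left(\frac1n\right),\qquad\text{where }\lambda_n=\frac{\log(2n)}{2}.$$
   Context: For a permutation $\sigma\in S_n$ with $\mu_j$ cycles of length $j$ ($j=1,\dots,n$) put $w(\sigma)=\prod_{j=1}^n\theta_j^{\mu_j}$ with $\theta_j=\zeta(2j)/2$, where $\zeta$ is the Riemann zeta function. $\mathbb P_{n,\infty,1/2}$ is the probability measure on the symmetric group $S_n$ with $\mathbb P_{n,\infty,1/2}(\sigma)=w(\sigma)/\sum_{\tau\in S_n}w(\tau)$. $\mathrm K_n(\sigma)$ is the number of disjoint cycles of $\sigma$, and $q_{n,\infty,1/2}(k)=\mathbb P_{n,\infty,1/2}(\mathrm K_n(\sigma)=k)$. For $\lambda>0$, the numbers $u_{\lambda,1/2}(k)$, $k\ge1$, are the coefficients of the Taylor expansion $$e^{\lambda(t-1)}\cdot\frac{t\cdot\Gamma(\frac32)}{\Gamma(1+\frac t2)}=\sum_{k\ge1}u_{\lambda,1/2}(k)\,t^k .$$ *)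

(* Defs.v *)
From mathcomp Require Import all_boot all_order all_algebra perm.
From mathcomp Require Import all_classical all_reals all_analysis.

Set Implicit Arguments.
Unset Strict Implicit.
Unset Printing Implicit Defensive.

Import Order.TTheory GRing.Theory Num.Theory.
Import numFieldNormedType.Exports.

Local Open Scope classical_set_scope.
Local Open Scope ring_scope.

(* Dirichlet series; a meaningful value of the zeta function only for s > 1. *)
Definition zeta (R : realType) (s : R) : R :=
  limn (series (fun m : nat => m.+1%:R `^ (- s))).

(* Euler's integral; a meaningful value of the Gamma function only for s > 0. *)
Definition Gamma (R : realType) (s : R) : R :=
  \int[@lebesgue_measure R]_(x in `]0, +oo[) (x `^ (s - 1) * expR (- x)).

Definition ncycles (n : nat) (s : 'S_n) : nat := #|porbits s|.

Definition ncycles_len (n : nat) (s : 'S_n) (j : nat) : nat :=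
  #|[set c in porbits s | #|c| == j]%SET|.

Definition theta (R : realType) (j : nat) : R := zeta (2 * j)%:R / 2.

Definition weight (R : realType) (n : nat) (s : 'S_n) : R :=
  \prod_(1 <= j < n.+1) theta R j ^+ ncycles_len s j.

Definition prob_perm (R : realType) (n : nat) (A : {set 'S_n}) : R :=
  (\sum_(s in A) weight R s) / (\sum_(s : 'S_n) weight R s).

Definition q_cycles (R : realType) (n k : nat) : R :=
  prob_perm R [set s : 'S_n | ncycles s == k]%SET.

Definition u_gen (R : realType) (lambda t : R) : R :=
  expR (lambda * (t - 1)) * (t * Gamma (3 / 2) / Gamma (1 + t / 2)).

(* k-th Taylor coefficient of u_gen lambda at t = 0.  The function is only
   considered for real t near 0 (where 1 + t / 2 > 0): this determines the
   coefficients of the power series, which has real coefficients. *)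
Definition u_coef (R : realType) (lambda : R) (k : nat) : R :=
  derive1n k (u_gen lambda) 0 / k`!%:R.

(* Main.v *)
(** By the exponential formula, the weighted count of the permutations of [n]
    elements by their number of cycles has the generating function
    [exp (t * sum_j theta_j z^j / j)], that is
    [(1 - z)^(-t/2) * exp (t * sum_j (theta_j - 1/2) z^j / j)].  The second
    factor has radius of convergence 4 and equals [2^(t/2)] at [z = 1], so that
    the coefficient of [z^n] is [2^(t/2)] times the coefficient [p_n(t)] of
    [z^n] in [(1 - z)^(-t/2)], up to a relative error [O(1/n)].  All errors are
    measured by the sum of the absolute values of the coefficients of a power
    series in [t]: this norm is submultiplicative, probability generating
    functions have norm 1, and no complex analysis is needed.  Finally
    [p_{N+1}(t)/p_{N+1}(1)] arises from [p_N(t)/p_N(1)] by multiplication with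
    the generating function of a Bernoulli variable, which differs from that of
    a Poisson variable of mean [log ((N+1)/N) / 2] by [O(1/N^2)].  Summing over
    [N >= n] compares [p_n(t)/p_n(1)] with the limit as [N] grows of
    [exp (log (n/N) (t-1) / 2) * p_N(t)/p_N(1)], which Gauss' product for the
    Gamma function identifies. *)

Require Import Defs.
From HB Require Import structures.
From mathcomp Require Import all_boot all_order all_algebra perm.
From mathcomp Require Import all_classical all_reals all_analysis.
From mathcomp Require Import measurable_realfun ring lra zify.
Import Order.TTheory GRing.Theory Num.Theory.
Import numFieldNormedType.Exports.
Local Open Scope classical_set_scope.
Local Open Scope ring_scope.

Set Implicit Arguments.
Unset Strict Implicit.
Unset Printing Implicit Defensive.

(** * Weighted counts of permutations by cycles *)

(** Uniformity in k is free, since each coefficient is bounded by the norm. The first obstacle is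
    that [bin_mass n] tends to 0, like n^(-1/2): errors made before normalisation have to be
    proportional to [bin_mass n / n]. Replacing n - i by n in the convolution loses a factor i
    (i+1)^2, which the geometric decay of the correction coefficients absorbs. These come from
    theta_j - 1/2 being half the sum of m^(-2j) over m >= 2, so that the correction factor is the
    product of (1 - z/m^2)^(-t/2) over m >= 2; at z = 1 the product of the 1 - 1/m^2 telescopes to
    1/2. The second obstacle is that for N > n the factor exp(log(n/N)(t-1)/2) belongs to a negative
    Poisson mean and has norm N/n. A uniform bound on its product with the law at N cannot come from
    bounding the factors, so it is bootstrapped from the one-step differences. The limit in N is
    found only for real t in (-1,1). That suffices: it is a power series with bounded coefficients,
    hence determined by its values near 0. *)

Lemma porbit_stable (T : finType) (s : {perm T}) (A : {set T}) (x : T) :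
  x \in A -> (forall y, y \in A -> s y \in A) -> porbit s x \subset A.
Proof.
move=> xA sA; apply/fintype.subsetP => _ /porbitP [i ->].
by elim: i => [|i IH]; rewrite ?perm1 // expgSr permM sA.
Qed.

Lemma porbit_eq_stable (T : finType) (s t : {perm T}) (x : T) :
  (forall y, y \in porbit t x -> s y = t y) -> porbit s x = porbit t x.
Proof.
move=> st.
have pow i : (s ^+ i)%g x = (t ^+ i)%g x.
  elim: i => [|i IH]; first by rewrite !perm1.
  by rewrite !expgSr !permM IH st // mem_porbit.
apply/setP => y; apply/porbitP/porbitP => -[i ->]; exists i; by rewrite pow.
Qed.

(** * Inserting a fixed point into a cycle by a transposition *)

Section Insertion.
Variables (T : finType) (L : {perm T}) (x y : T).
Hypotheses (Lx : L x = x) (yx : y != x).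
Let s := (tperm x y * L)%g.

Lemma insert_perm_x : s x = L y.
Proof. by rewrite permM tpermL. Qed.

Lemma insert_perm_y : s y = x.
Proof. by rewrite permM tpermR. Qed.

Lemma insert_perm_other z : z != x -> z != y -> s z = L z.
Proof. by move=> zx zy; rewrite permM tpermD // eq_sym. Qed.

Lemma porbit_fixed z : (x \in porbit L z) = (z == x).
Proof.
apply/idP/eqP => [/porbitP [i xz]|->]; last exact: porbit_id.
suff : (L ^+ i)%g z = (L ^+ i)%g x by move/perm_inj.
rewrite -xz; elim: i {xz} => [|i IH]; first by rewrite perm1.
by rewrite expgSr permM -IH Lx.
Qed.

Lemma insert_porbit_x : porbit s x = x |: porbit L y.
Proof.
have xNL : x \notin porbit L y by rewrite porbit_fixed.
apply/eqP; rewrite finset.eqEsubset; apply/andP; split.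
  apply: porbit_stable => [|z]; first by rewrite !inE eqxx.
  rewrite !inE => /orP[/eqP ->|zL].
    by rewrite insert_perm_x (mem_porbit L 1) orbT.
  have [->|zy] := eqVneq z y; first by rewrite insert_perm_y eqxx.
  have zx : z != x by apply: contraNneq xNL => <-.
  by rewrite insert_perm_other // -eq_porbit_mem (porbit_perm L 1) eq_porbit_mem zL orbT.
rewrite finset.subUset finset.sub1set porbit_id /=.
apply/fintype.subsetP => _ /porbitP [i ->].
have yi : (s ^+ 1)%g y = x by rewrite expg1 insert_perm_y.
elim: i => [|i IH].
  by rewrite perm1 porbit_sym -yi mem_porbit.
rewrite expgSr permM; set z := (L ^+ i)%g y in IH *.
have [->|zy] := eqVneq z y; first by rewrite -insert_perm_x (mem_porbit s 1).
have zx : z != x by apply: contraNneq xNL => <-; exact: mem_porbit.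
by rewrite -insert_perm_other // -eq_porbit_mem (porbit_perm s 1) eq_porbit_mem.
Qed.

Lemma insert_porbit_other z : z != x -> z \notin porbit L y ->
  porbit s z = porbit L z.
Proof.
move=> zx zL; apply: porbit_eq_stable => w wz; apply: insert_perm_other.
  by apply: contraNneq zx => wx; rewrite -porbit_fixed -wx.
by apply: contraNneq zL => wy; rewrite porbit_sym -wy.
Qed.

End Insertion.

(** * The exponential formula, by deletion of points *)

Section CycleSums.
Variables (P : comNzRingType) (T : finType) (a : nat -> P).

(** The carrier type stays fixed while points are deleted from [S]; a deleted point is fixed by [s]
    and must not count as a cycle. *)
Definition cyc_weight (S : {set T}) (s : {perm T}) : P :=
  \prod_(c in (porbit s @: S)%SET) a #|c|.

Definition cyc_sum (S : {set T}) : P := \sum_(s | perm_on S s) cyc_weight S s.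

(* The cycle of [x] is weighted as if it had [j] additional elements; this is
   what makes a recursion by deletion of single elements close up. *)
Definition mark_weight (S : {set T}) (x : T) (j : nat) (s : {perm T}) : P :=
  a (#|porbit s x| + j) * \prod_(c in (porbit s @: S)%SET | c != porbit s x) a #|c|.

Definition mark_sum (S : {set T}) (x : T) (j : nat) : P :=
  \sum_(s | perm_on S s) mark_weight S x j s.

Lemma cyc_sum_mark (S : {set T}) x : x \in S -> cyc_sum S = mark_sum S x 0.
Proof.
move=> xS; apply: eq_bigr => s _.
by rewrite /mark_weight addn0 /cyc_weight (bigD1 (porbit s x)) // imset_f.
Qed.

Lemma cyc_sum0 : cyc_sum finset.set0 = 1.
Proof.
rewrite /cyc_sum (big_pred1 (1%g : {perm T})) /cyc_weight ?imset0 ?big_set0 // => s.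
apply/idP/eqP => [s0|->]; last exact: perm_on1.
by apply: (perm_on_id s0); rewrite cards0.
Qed.

Lemma mark_weight_insert (S : {set T}) x y j L : x \in S -> perm_on (S :\ x) L ->
  y \in S :\ x ->
  mark_weight S x j (tperm x y * L)%g = mark_weight (S :\ x) y j.+1 L.
Proof.
move=> xS LS; rewrite 2!inE => /andP[yx yS].
have Lx : L x = x by apply: (out_perm LS); rewrite !inE eqxx.
have xLy : x \notin porbit L y by rewrite porbit_fixed.
rewrite /mark_weight insert_porbit_x // cardsU1 xLy /= add1n addSnnS.
congr (_ * _); apply: eq_bigl => c; apply/andP/andP => -[/imsetP [z zS ->] cx].
  have zN : z \notin porbit (tperm x y * L) x by rewrite -eq_porbit_mem insert_porbit_x.
  move: zN; rewrite insert_porbit_x // !inE negb_or => /andP[zx zL].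
  rewrite insert_porbit_other //; split; first by apply: imset_f; rewrite !inE zx.
  by rewrite eq_porbit_mem.
move: zS; rewrite !inE => /andP[zx zS].
rewrite eq_porbit_mem in cx.
rewrite -(insert_porbit_other Lx (y := y)) //; split; first exact: imset_f.
by rewrite -insert_porbit_x // eq_porbit_mem insert_porbit_x // !inE negb_or zx.
Qed.

Lemma mark_weight_fixed (S : {set T}) x j L : x \in S -> perm_on (S :\ x) L ->
  mark_weight S x j L = a j.+1 * cyc_weight (S :\ x) L.
Proof.
move=> xS LS.
have Lx : L x = x by apply: (out_perm LS); rewrite !inE eqxx.
have Ox : porbit L x = [set x]%SET.
  apply/setP => z; rewrite porbit_sym inE.
  by rewrite porbit_fixed.
rewrite /mark_weight /cyc_weight Ox cards1 add1n.
congr (_ * _); apply: eq_bigl => c; apply/andP/idP => [[/imsetP [z zS ->] cx]|/imsetP [z zS ->]].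
  apply: imset_f; rewrite !inE zS andbT.
  by apply: contraNneq cx => ->; rewrite Ox.
move: zS; rewrite !inE => /andP[zx zS]; split; first exact: imset_f.
by rewrite -Ox eq_porbit_mem porbit_sym porbit_fixed.
Qed.

(** Delete [x] and look at its preimage y. If y = x, a whole cycle disappears. Otherwise [x] is
    bypassed: the cycle of y is one shorter and its mark one larger. *)
Lemma mark_sum_rec (S : {set T}) x j : x \in S ->
  mark_sum S x j = a j.+1 * cyc_sum (S :\ x) +
    \sum_(y in S :\ x) mark_sum (S :\ x) y j.+1.
Proof.
move=> xS; rewrite /mark_sum.
rewrite (partition_big (fun s : {perm T} => (s^-1)%g x) (mem S)) /=; last first.
  by move=> s sS; rewrite perm_closed // perm_onV.
(* The permutations sending [y] to [x] are the products [tperm x y * L] with [L] supported off [x];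
   for y = x the transposition is trivial. *)
have E y : y \in S -> \sum_(s : {perm T} | perm_on S s && ((s^-1)%g x == y)) mark_weight S x j s =
    \sum_(L | perm_on (S :\ x) L) mark_weight S x j (tperm x y * L)%g.
  move=> yS; rewrite (reindex (fun L : {perm T} => tperm x y * L)%g) /=; last first.
    by exists (fun s : {perm T} => (tperm x y * s)%g) => s _; rewrite mulgA tperm2 mul1g.
  apply: eq_bigl => L.
  have -> : (((tperm x y * L)^-1)%g x == y) = (L x == x).
    rewrite invgM permM tpermV; apply/eqP/eqP => [H|H].
      have : L ((L^-1)%g x) = x by rewrite permKV.
      have -> : (L^-1)%g x = x.
        by apply: (@perm_inj _ (tperm x y)); rewrite H tpermL.
      by [].
    have -> : (L^-1)%g x = x by apply: (@perm_inj _ L); rewrite permKV.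
    by rewrite tpermL.
  have tS : perm_on S (tperm x y).
    by apply: (fintype.subset_trans (tperm_on x y)); rewrite finset.subUset !finset.sub1set xS yS.
  apply/andP/idP => [[H /eqP Lx]|LS].
    have LS : perm_on S L.
      by rewrite -[L]mul1g -(tperm2 x y) -mulgA perm_onM.
    apply/fintype.subsetP => z Lz; rewrite !inE (fintype.subsetP LS z Lz) andbT.
    by apply: contraTneq Lz => ->; rewrite inE Lx eqxx.
  split.
    apply: perm_onM => //; apply: (fintype.subset_trans LS); exact: finset.subD1set.
  by apply/eqP/(out_perm LS); rewrite !inE eqxx.
rewrite (eq_bigr _ E) (bigD1 x) //=; congr (_ + _).
  rewrite /cyc_sum big_distrr /=; apply: eq_bigr => L LS.
  by rewrite tperm1 mul1g mark_weight_fixed.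
apply: eq_big => [y|y /andP [yS yx]]; first by rewrite !inE andbC.
apply: eq_bigr => L LS; apply: mark_weight_insert => //.
by rewrite !inE yx.
Qed.

(** For the generating series H(z) the recursion says z H' = A H with A the sum of the a_j z^j, so H
    is the exponential of the sum of the a_j z^j / j. *)
Lemma cyc_sum_eq (H : nat -> P) : H 0%N = 1 ->
  (forall n, n.+1%:R * H n.+1 = \sum_(i < n.+1) a i.+1 * H (n - i)%N) ->
  forall S, cyc_sum S = (#|S|)`!%:R * H #|S|.
Proof.
move=> H0 HS.
(* The marked sums are carried along in the induction. There [i.+1] is the true length of the cycle
   of [x], and the other [n - i] points are permuted freely. *)
suff main n : (forall S : {set T}, #|S| = n -> cyc_sum S = n`!%:R * H n) /\
    (forall (S : {set T}) x j, #|S| = n.+1 -> x \in S ->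
       mark_sum S x j = n`!%:R * \sum_(i < n.+1) a (i.+1 + j)%N * H (n - i)%N).
  by move=> S; have [C _] := main #|S|; exact: C.
elim: n => [|n [IHc IHm]].
  have C0 (S : {set T}) : #|S| = 0%N -> cyc_sum S = 0`!%:R * H 0%N.
    by move=> /cards0_eq ->; rewrite cyc_sum0 H0 mulr1.
  split=> // S x j S1 xS.
  have Sx : #|S :\ x| = 0%N by move: (cardsD1 x S); rewrite xS S1 => -[].
  rewrite mark_sum_rec // (C0 _ Sx) (cards0_eq Sx) big_set0 addr0 big_ord1.
  by rewrite add1n mulrCA.
have Cn (S : {set T}) : #|S| = n.+1 -> cyc_sum S = n.+1`!%:R * H n.+1.
  move=> Sn; have [x xS] : exists x, x \in S by apply/set0Pn; rewrite -card_gt0 Sn.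
  rewrite (cyc_sum_mark xS) IHm //.
  under eq_bigr do rewrite addn0.
  by rewrite -HS factS natrM mulrCA mulrA.
split=> // S x j Sn xS.
have Sx : #|S :\ x| = n.+1 by move: (cardsD1 x S); rewrite xS Sn => -[].
rewrite mark_sum_rec // Cn // (eq_bigr (fun=> n`!%:R * \sum_(i < n.+1) a (i.+1 + j.+1)%N * H (n - i)%N)); last first.
  by move=> y yS; rewrite IHm.
rewrite sumr_const Sx [in RHS]big_ord_recl /= add1n subn0 mulrDr mulrCA; congr (_ + _).
rewrite -[LHS]mulr_natl factS natrM -mulrA; congr (_ * _); congr (_ * _).
by apply: eq_bigr => i _; rewrite /bump /= add1n subSS addnS.
Qed.

End CycleSums.

(** * Formal power series *)

Definition fps (R : comNzRingType) : Type := nat -> R.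

Section FormalSeries.
Variable R : comNzRingType.
Implicit Types a b c : fps R.

HB.instance Definition _ := GRing.Zmodule.copy (fps R) (nat -> R).

Definition fps_one : fps R := fun n => (n == 0%N)%:R.

Definition fps_mul a b : fps R := fun n => \sum_(i < n.+1) a i * b (n - i)%N.

(** A coefficient of a Cauchy product sees finitely many coefficients, so the ring laws can be
    inherited from polynomials. *)
Lemma coef_trunc_mul a b N k : (k < N)%N ->
  ((\poly_(i < N) a i) * (\poly_(i < N) b i))`_k = fps_mul a b k.
Proof.
move=> kN; rewrite coefM; apply: eq_bigr => i _.
rewrite !coef_poly (leq_ltn_trans _ kN) ?(leq_ltn_trans _ kN) ?leq_subr //.
by rewrite -ltnS.
Qed.

Lemma fps_mulC : commutative fps_mul.
Proof.
move=> a b; apply/funext => n.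
by rewrite -!(@coef_trunc_mul _ _ n.+1) // mulrC.
Qed.

Lemma fps_mulA : associative fps_mul.
Proof.
have E (a b c : fps R) n : fps_mul (fps_mul a b) c n =
    ((\poly_(i < n.+1) a i) * (\poly_(i < n.+1) b i) * (\poly_(i < n.+1) c i))`_n.
  rewrite coefM; apply: eq_bigr => i _.
  by rewrite (@coef_trunc_mul _ _ n.+1) // coef_poly ltnS leq_subr.
move=> a b c; rewrite [RHS](_ : _ = fps_mul (fps_mul b a) c); last by rewrite (fps_mulC a b).
rewrite [LHS](_ : _ = fps_mul (fps_mul b c) a); last by rewrite fps_mulC.
by apply/funext => n; rewrite !E mulrAC.
Qed.

Lemma fps_mul1 : left_id fps_one fps_mul.
Proof.
move=> a; apply/funext => n; rewrite /fps_mul big_ord_recl /= mul1r subn0.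
by rewrite big1 ?addr0 // => i _; rewrite mul0r.
Qed.

Lemma fps_mulDl : left_distributive fps_mul +%R.
Proof.
move=> a b c; apply/funext => n; rewrite /fps_mul.
rewrite [RHS](_ : _ = (\sum_(i < n.+1) a i * c (n - i)%N) +
  (\sum_(i < n.+1) b i * c (n - i)%N)) // -big_split.
by apply: eq_bigr => i _; rewrite /= -mulrDl.
Qed.

Lemma fps_one_neq0 : fps_one != 0.
Proof. by apply/eqP => /(congr1 (fun f => f 0%N)) /eqP; rewrite oner_eq0. Qed.

HB.instance Definition _ := GRing.Zmodule_isComNzRing.Build (fps R)
  fps_mulA fps_mulC fps_mul1 fps_mulDl fps_one_neq0.

Lemma fpsM a b n : (a * b) n = \sum_(i < n.+1) a i * b (n - i)%N.
Proof. by []. Qed.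

Lemma fpsD a b n : (a + b) n = a n + b n.
Proof. by []. Qed.

Lemma fpsN a n : (- a) n = - a n.
Proof. by []. Qed.

Lemma fpsB a b n : (a - b) n = a n - b n.
Proof. by []. Qed.

Lemma fps1 n : (1 : fps R) n = (n == 0%N)%:R.
Proof. by []. Qed.

Lemma fps0 n : (0 : fps R) n = 0.
Proof. by []. Qed.

Lemma fps_sum (I : Type) (r : seq I) (Q : pred I) (F : I -> fps R) n :
  (\sum_(i <- r | Q i) F i) n = \sum_(i <- r | Q i) F i n.
Proof. by elim/big_rec2: _ => // i x y _ <-. Qed.

Lemma fpsMn a m n : (a *+ m) n = a n *+ m.
Proof. by elim: m => [|m IH]; rewrite ?mulr0n // !mulrS -IH. Qed.

Definition fpsC (x : R) : fps R := fun n => x *+ (n == 0%N).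

Lemma fpsCM x a n : (fpsC x * a) n = x * a n.
Proof.
rewrite fpsM big_ord_recl /= subn0 big1 ?addr0 // => i _.
by rewrite /fpsC /= mul0r.
Qed.

Lemma fps_exp0 a k : a 0%N = 0 -> (a ^+ k.+1) 0%N = 0.
Proof. by move=> a0; rewrite exprS fpsM big_ord1 a0 mul0r. Qed.

Lemma fps_exp_lt a k n : a 0%N = 0 -> (n < k)%N -> (a ^+ k) n = 0.
Proof.
move=> a0; elim: k n => // k IH n nk; rewrite exprS fpsM big_ord_recl a0 mul0r add0r.
rewrite big1 // => i _; rewrite /= /bump /= add1n IH ?mulr0 //.
have := ltn_ord i; move: nk; case: n i => [[]//|n] i nk _.
by rewrite subSS; apply: leq_ltn_trans (leq_subr _ _) _.
Qed.

(** The derivation z d/dz, which unlike d/dz does not shift the index. *)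
Definition euler a : fps R := fun n => n%:R * a n.

Lemma eulerM a b : euler (a * b) = euler a * b + a * euler b.
Proof.
apply/funext => n; rewrite fpsD !fpsM /euler big_distrr -big_split.
apply: eq_bigr => i _ /=; have /subnKC {1}<- : (i <= n)%N by rewrite -ltnS.
by rewrite natrD; ring.
Qed.

Lemma eulerX a k : euler (a ^+ k.+1) = (a ^+ k * euler a) *+ k.+1.
Proof.
elim: k => [|k IH]; first by rewrite expr1 expr0 mul1r.
rewrite exprSr eulerM IH [RHS]mulrSr; congr (_ + _).
by rewrite exprSr mulrnAl mulrAC.
Qed.

End FormalSeries.

(** * Taylor coefficients of a power series *)

Section TaylorCoefficients.
Variable R : realType.
Implicit Types (c : R^nat) (f : R -> R) (M rho x : R).

Lemma is_cvg_pseries_geometric c M rho x : 0 <= rho ->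
  (forall k, `|c k| <= M * rho ^+ k) -> `|x| * rho < 1 -> cvgn (pseries c x).
Proof.
move=> rho0 cM xr; apply: normed_cvg.
apply: (@series_le_cvg _ _ (geometric M (`|x| * rho))).
- by move=> n; exact: normr_ge0.
- move=> n; rewrite mulr_ge0 ?exprn_ge0 ?mulr_ge0 //.
  by have := cM 0%N; rewrite expr0 mulr1; apply: le_trans.
- move=> n /=; rewrite normrM normrX exprMn mulrCA mulrC.
  by apply: ler_wpM2l => //; rewrite exprn_ge0.
- by apply: is_cvg_geometric_series; rewrite ger0_norm // mulr_ge0.
Qed.

(** Geometric bounds survive differentiation at a doubled rate because k + 1 <= 2^k; this makes the
    induction in [derive1n_pseries] possible. *)
Lemma pseries_diffs_geometric c M rho : 0 <= rho ->
  (forall k, `|c k| <= M * rho ^+ k) ->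
  forall k, `|pseries_diffs c k| <= M * rho * (2 * rho) ^+ k.
Proof.
move=> rho0 cM k; rewrite /pseries_diffs normrM exprMn.
have M0 : 0 <= M by have := cM 0%N; rewrite expr0 mulr1; apply: le_trans.
rewrite mulrCA -mulrA -exprS ler_pM // normr_nat -natrX ler_nat.
exact: ltn_expl.
Qed.

Lemma limn_pseries0 c : limn (pseries c 0) = c 0%N.
Proof.
apply: cvg_lim => //; rewrite -(cvg_shiftn 1) /=.
rewrite (_ : (fun n => _) = fun=> c 0%N); first exact: cvg_cst.
apply/funext => n; rewrite /pseries /series /= addn1 big_nat_recl // expr0 mulr1.
by rewrite big1 ?addr0 // => i _; rewrite expr0n mulr0.
Qed.

Lemma derive1n_pseries k c M rho f : 0 < rho ->
  (forall k, `|c k| <= M * rho ^+ k) ->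
  (\forall x \near (0 : R), f x = limn (pseries c x)) ->
  derive1n k f 0 = k`!%:R * c k.
Proof.
elim: k c M rho f => [|k IH] c M rho f rho0 cM fc.
  by rewrite derive1n0 (nbhs_singleton fc) limn_pseries0 mul1r.
have d1 := pseries_diffs_geometric (ltW rho0) cM.
have d2 := pseries_diffs_geometric (mulr_ge0 (ler0n _ _) (ltW rho0)) d1.
rewrite /derive1n iterSr -/(derive1n k _).
rewrite (IH (pseries_diffs c) (M * rho) (2 * rho)) //; last 2 first.
- by rewrite mulr_gt0.
(* The rates for the series and its first two derivatives are rho, 2 rho and 4 rho; at K = 1/(8 rho)
   all three series converge. *)
- pose K := (8 * rho)^-1.
  have K0 : 0 < K by rewrite invr_gt0 mulr_gt0.
  have Kr : K * rho = 8^-1 by rewrite /K; field; rewrite gt_eqF.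
  near=> x.
  have xK : `|x| < `|K|.
    rewrite (ger0_norm (ltW K0)); near: x; exact: (@nbhs0_lt R R^o).
  have nK : `|K| = K by rewrite ger0_norm // ltW.
  have c0 : cvgn (pseries c K).
    by apply: is_cvg_pseries_geometric cM _; [exact: ltW|rewrite nK; lra].
  have c1 : cvgn (pseries (pseries_diffs c) K).
    by apply: is_cvg_pseries_geometric d1 _; [rewrite mulr_ge0 ?ltW|rewrite nK; lra].
  have c2 : cvgn (pseries (pseries_diffs (pseries_diffs c)) K).
    by apply: is_cvg_pseries_geometric d2 _; [rewrite !mulr_ge0 ?ltW|rewrite nK; lra].
  have h := pseries_snd_diffs c0 c1 c2 xK.
  rewrite derive1E (@near_eq_derive _ _ _ _ (fun x => limn (pseries c x))).
    by case: h => _ ->.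
  near: x; exact: (nbhs_interior fc).
by rewrite /pseries_diffs mulrCA mulrA -natrM factS.
Unshelve. all: by end_near. Qed.

End TaylorCoefficients.

(** * Absolutely summable coefficients *)

Lemma series_fpsM (R : realType) (a b : fps R) N :
  series (a * b : nat -> R) N = \sum_(0 <= i < N) a i * series b (N - i)%N.
Proof.
rewrite /series /= big_mkord.
rewrite (eq_bigr (fun k : 'I_N => \sum_(i < N | (i <= k)%N) a i * b (k - i)%N)); last first.
  move=> k _; rewrite fpsM (big_ord_widen N (fun i => a i * b (k - i)%N)) //.
rewrite (exchange_big_dep predT) //= big_mkord; apply: eq_bigr => i _.
rewrite -big_distrr /=; congr (_ * _).
rewrite -(big_mkord (fun k => (i <= k)%N) (fun k => b (k - i)%N)).
rewrite (@big_cat_nat _ _ _ i) //=; last exact: ltnW.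
rewrite big_nat_cond big_pred0 ?add0r; last first.
  by move=> k; rewrite andbC leqNgt; case: (k < i)%N; rewrite ?andbF.
rewrite -{1}[nat_of_ord i]add0n big_addn big_nat_cond [RHS]big_nat_cond.
apply: eq_big => [k|k _]; last by rewrite addnK.
by rewrite leq_addl.
Qed.

Lemma cvg_sum_nat (R : realType) (u : nat -> nat -> R) (v : nat -> R) N :
  (forall k, u k n @[n --> \oo] --> v k) ->
  \sum_(0 <= k < N) u k n @[n --> \oo] --> \sum_(0 <= k < N) v k.
Proof.
move=> uv; elim: N => [|N IH].
  by under eq_fun do rewrite big_nil; rewrite big_nil; exact: cvg_cst.
under eq_fun do rewrite big_nat_recr //=.
by rewrite big_nat_recr //=; apply: cvgD => //; exact: uv.
Qed.

Section SummableSeries.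
Variable R : realType.
Implicit Types a b : fps R.

(** Bounding the partial sums avoids any convergence side condition and lets the bound pass to
    coefficientwise limits. *)
Definition l1le a (M : R) := forall N, series (fun k => `|a k|) N <= M.

Lemma l1le_ge0 a M : l1le a M -> 0 <= M.
Proof. by move=> /(_ 0%N); rewrite /series /= big_nil. Qed.

Lemma l1le_coef a M k : l1le a M -> `|a k| <= M.
Proof.
move=> /(_ k.+1); apply: le_trans.
by rewrite /series /= big_nat_recr //= lerDr sumr_ge0.
Qed.

Lemma l1leW a M M' : l1le a M -> M <= M' -> l1le a M'.
Proof. by move=> aM MM N; apply: le_trans MM. Qed.

Lemma l1leN a M : l1le a M -> l1le (- a) M.
Proof.
move=> aM N; have := aM N; rewrite /series /=.
by under [in X in _ -> X]eq_bigr do rewrite fpsN normrN.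
Qed.

Lemma l1leD a b A B : l1le a A -> l1le b B -> l1le (a + b) (A + B).
Proof.
move=> aA bB N; apply: le_trans (lerD (aA N) (bB N)).
rewrite /series /= -big_split /=; apply: ler_sum => k _.
exact: ler_normD.
Qed.

Lemma l1leB a b A B : l1le a A -> l1le b B -> l1le (a - b) (A + B).
Proof. by move=> aA bB; apply: l1leD => //; exact: l1leN. Qed.

Lemma l1le0 : l1le 0 0.
Proof. by move=> N; rewrite /series /= big1 // => k _; rewrite fps0 normr0. Qed.

Lemma l1le_sum (I : Type) (r : seq I) (P : pred I) (F : I -> fps R) (M : I -> R) :
  (forall i, P i -> l1le (F i) (M i)) ->
  l1le (\sum_(i <- r | P i) F i) (\sum_(i <- r | P i) M i).
Proof.
move=> FM; elim/big_rec2: _ => [|i y x Pi yx]; first exact: l1le0.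
by apply: l1leD => //; exact: FM.
Qed.

Lemma l1leM a b A B : l1le a A -> l1le b B -> l1le (a * b) (A * B).
Proof.
move=> aA bB N; pose a' : fps R := fun k => `|a k|; pose b' : fps R := fun k => `|b k|.
apply: (@le_trans _ _ (series (a' * b' : nat -> R) N)).
  apply: ler_sum => k _; rewrite !fpsM; apply: le_trans (ler_norm_sum _ _ _) _.
  by apply: ler_sum => i _; rewrite normrM.
rewrite series_fpsM; apply: (@le_trans _ _ (\sum_(0 <= i < N) a' i * B)).
  by apply: ler_sum => i _; apply: (ler_wpM2l (normr_ge0 _)); exact: bB.
by rewrite -big_distrl /= ler_wpM2r ?(l1le_ge0 bB) //; exact: aA.
Qed.

Lemma l1le1 : l1le 1 1.
Proof.
case=> [|N]; rewrite /series /= ?big_nil // big_nat_recl // fps1 normr1.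
by rewrite big1 ?addr0 // => k _; rewrite fps1 normr0.
Qed.

Lemma l1leX a A k : l1le a A -> l1le (a ^+ k) (A ^+ k).
Proof. by move=> aA; elim: k => [|k IH]; rewrite ?exprS; [exact: l1le1|exact: l1leM]. Qed.

Lemma l1leC x a A : l1le a A -> l1le (fpsC x * a) (`|x| * A).
Proof.
move=> aA; apply: l1leM aA; case=> [|N]; rewrite /series /= ?big_nil //.
rewrite big_nat_recl // big1 ?addr0 // => k _.
by rewrite /fpsC mulr0n normr0.
Qed.

(** Fatou's lemma for sums: each partial sum involves only finitely many coefficients. *)
Lemma l1le_cvg (a_ : nat -> fps R) a M :
  (forall k, a_ n k @[n --> \oo] --> a k) -> (\forall n \near \oo, l1le (a_ n) M) ->
  l1le a M.
Proof.
move=> cv aM N.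
have h : series (fun k => `|a_ n k|) N @[n --> \oo] --> series (fun k => `|a k|) N.
  by apply: (@cvg_sum_nat _ (fun k n => `|a_ n k|)) => k; exact: cvg_norm.
rewrite -(cvg_lim _ h) //; apply: limr_le; first by apply/cvg_ex; eexists; exact: h.
by near=> n; near: n; apply: filterS aM => n; apply.
Unshelve. all: by end_near. Qed.

Lemma l1le_nneg a l : (forall k, 0 <= a k) -> series (a : nat -> R) @ \oo --> l -> l1le a l.
Proof.
move=> a0 al N.
have -> : (fun k => `|a k|) = a by apply/funext => k; rewrite ger0_norm.
rewrite -(cvg_lim _ al) //; apply: nondecreasing_cvgn_le; last by apply/cvg_ex; exists l.
by apply/nondecreasing_seqP => n; rewrite /series /= big_nat_recr //= lerDl.
Qed.

Definition fps_scale (t : R) a : fps R := fun k => a k * t ^+ k.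

Lemma fps_scaleM t a b : fps_scale t (a * b) = fps_scale t a * fps_scale t b.
Proof.
apply/funext => n; rewrite /fps_scale !fpsM big_distrl /=; apply: eq_bigr => i _.
have iN : (i <= n)%N by rewrite -ltnS.
by rewrite -[in t ^+ n](subnKC iN) exprD mulrACA.
Qed.

Lemma fps_scaleX t a k : fps_scale t (a ^+ k) = fps_scale t a ^+ k.
Proof.
elim: k => [|k IH]; last by rewrite !exprS fps_scaleM IH.
by apply/funext => -[|n]; rewrite !expr0 /fps_scale !fps1 ?mul1r ?mul0r.
Qed.

Lemma fps_scale_series t a : series (fps_scale t a) = pseries a t.
Proof. by []. Qed.

Lemma pseries_tail t a A (v : R) m : `|t| <= 1 -> l1le a A -> pseries a t @ \oo --> v ->
  `|pseries a t m - v| <= `|t| ^+ m * A.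
Proof.
move=> t1 aA av.
have h : `|pseries a t m - pseries a t n| @[n --> \oo] --> `|pseries a t m - v|.
  by apply: cvg_norm; apply: cvgB => //; exact: cvg_cst.
rewrite -(cvg_lim _ h) //; apply: limr_le; first by apply/cvg_ex; eexists; exact: h.
near=> n; have mn : (m <= n)%N by near: n; exact: nbhs_infty_ge.
rewrite distrC /pseries /series /= (@big_cat_nat _ _ _ m) //= addrAC subrr add0r.
apply: le_trans (ler_norm_sum _ _ _) _.
apply: (@le_trans _ _ (\sum_(m <= k < n) `|t| ^+ m * `|a k|)).
  apply: ler_sum_nat => k /andP[mk _]; rewrite normrM normrX mulrC.
  by rewrite ler_wpM2r // ler_wiXn2l.
rewrite -big_distrr /= ler_wpM2l ?exprn_ge0 //; apply: le_trans (aA n).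
by rewrite /series /= (@big_cat_nat _ _ _ m 0 n) //= lerDr sumr_ge0.
Unshelve. all: by end_near. Qed.

(** In the partial sum of the product, the i-th term of [a] meets a truncation of [b] at N - i, with
    error of order |t|^(N-i). Its own factor |t|^i completes this to |t|^N. *)
Lemma cvg_pseriesM t a b A B (v w : R) : `|t| < 1 -> l1le a A -> l1le b B ->
  pseries a t @ \oo --> v -> pseries b t @ \oo --> w ->
  pseries (a * b) t @ \oo --> v * w.
Proof.
move=> t1 aA bB av bw.
have key N : `|pseries (a * b) t N - pseries a t N * w| <= A * B * `|t| ^+ N.
  rewrite -fps_scale_series fps_scaleM series_fpsM.
  rewrite /pseries [in X in _ - X]/series /= mulr_suml -sumrB.
  apply: le_trans (ler_norm_sum _ _ _) _.
  apply: (@le_trans _ _ (\sum_(0 <= i < N) `|a i| * (B * `|t| ^+ N))).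
    apply: ler_sum_nat => i /andP[_ iN].
    rewrite -mulrBr normrM /fps_scale normrM normrX -mulrA ler_wpM2l //.
    apply: le_trans (ler_wpM2l (exprn_ge0 _ (normr_ge0 _)) (pseries_tail _ (ltW t1) bB bw)) _.
    by rewrite mulrA -exprD subnKC ?(ltnW iN) // mulrC.
  by rewrite -mulr_suml -mulrA ler_wpM2r ?mulr_ge0 ?exprn_ge0 ?(l1le_ge0 bB) //; exact: aA.
have h0 : A * B * `|t| ^+ N @[N --> \oo] --> (0 : R).
  rewrite -(mulr0 (A * B)); apply: cvgMl_tmp; apply: cvg_expr.
  by rewrite normr_id.
have h1 : (pseries (a * b) t N - pseries a t N * w) @[N --> \oo] --> (0 : R).
  apply/cvgr0Pnorm_lt => e e0; near=> N; apply: le_lt_trans (key N) _.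
  rewrite -(ger0_norm (_ : 0 <= A * B * `|t| ^+ N)); last first.
    by rewrite !mulr_ge0 ?exprn_ge0 ?(l1le_ge0 bB) ?(l1le_ge0 aA).
  by near: N; move/cvgr0Pnorm_lt : h0; apply.
have h2 : pseries a t N * w @[N --> \oo] --> v * w by apply: cvgMr_tmp.
have h3 := cvgD h1 h2; rewrite add0r in h3.
apply: cvg_trans (h3 _); apply: near_eq_cvg; near=> N.
by rewrite /= subrK.
Unshelve. all: by end_near. Qed.

Lemma is_cvg_l1le t a A : `|t| < 1 -> l1le a A -> cvgn (pseries a t).
Proof.
move=> t1 aA; apply: (@is_cvg_pseries_geometric _ _ A 1) => //; last by rewrite mulr1.
by move=> k; rewrite expr1n mulr1; exact: l1le_coef.
Qed.

(* Coefficients of [exp (c (t - 1))]. *)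
Definition poisson (c : R) : fps R := fun k => expR (- c) * (c ^+ k / k`!%:R).

Lemma poissonD c d : poisson (c + d) = poisson c * poisson d.
Proof.
apply/funext => n; rewrite fpsM /poisson opprD expRD.
rewrite addrC exprDn mulr_suml mulr_sumr; apply: eq_bigr => i _.
have iN : (i <= n)%N by rewrite -ltnS.
rewrite -(bin_fact iN) !natrM -mulr_natl.
have h1 : 'C(n, i)%:R != 0 :> R by rewrite pnatr_eq0 -lt0n bin_gt0.
have h2 : i`!%:R != 0 :> R by rewrite pnatr_eq0 -lt0n fact_gt0.
have h3 : (n - i)`!%:R != 0 :> R by rewrite pnatr_eq0 -lt0n fact_gt0.
field; rewrite h1 h2 h3 //.
Qed.

Lemma poisson0 : poisson 0 = 1.
Proof.
apply/funext => -[|k]; rewrite /poisson fps1 oppr0 expR0 mul1r expr0n /= ?mul0r //.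
by rewrite divr1.
Qed.

Lemma cvg_pseries_poisson c t : pseries (poisson c) t @ \oo --> expR (c * (t - 1)).
Proof.
have -> : pseries (poisson c) t = (fun n => expR (- c) * series (exp_coeff (c * t)) n).
  apply/funext => n; rewrite /pseries /series /= mulr_sumr; apply: eq_bigr => k _.
  by rewrite /poisson exp_coeffE exprMn; ring.
have -> : expR (c * (t - 1)) = expR (- c) * expR (c * t) by rewrite -expRD; congr expR; ring.
apply: cvgMl_tmp; exact: is_cvg_series_exp_coeff.
Qed.

Lemma poisson_ge0 c k : 0 <= c -> 0 <= poisson c k.
Proof. by move=> c0; rewrite mulr_ge0 ?expR_ge0 // divr_ge0 ?exprn_ge0. Qed.

Lemma l1le_poisson c : 0 <= c -> l1le (poisson c) 1.
Proof.
move=> c0; apply: l1le_nneg => [k|]; first exact: poisson_ge0.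
have := @cvg_pseries_poisson c 1; rewrite subrr mulr0 expR0.
rewrite (_ : pseries _ _ = series (poisson c)) //; apply/funext => n.
by apply: eq_bigr => k _; rewrite /= expr1n mulr1.
Qed.

(** Up to signs, the coefficients of [poisson (- c)] are exp(2c) times those of [poisson c]. *)
Lemma l1le_poissonN c : 0 <= c -> l1le (poisson (- c)) (expR (2 * c)).
Proof.
move=> c0; have := l1leC (expR (2 * c)) (l1le_poisson c0).
rewrite ger0_norm ?expR_ge0 // mulr1 => h N; apply: le_trans (h N).
apply: ler_sum => k _; rewrite fpsCM /poisson opprK [in leRHS]mulrA [in leRHS]mulrA [in leRHS]mulrA -expRD -mulrA.
by rewrite (_ : 2 * c - c = c); [rewrite !normrM !normrX normrN|ring].
Qed.

End SummableSeries.

(** * Even zeta values *)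

Section ZetaValues.
Variable R : realType.

(** The shift by two removes the term 1 of the zeta series, which is the one responsible for (1 -
    z)^(-t/2). *)
Definition inv_sqr (m : nat) : R := (m.+2%:R ^+ 2)^-1.

Definition zeta_tail (j M : nat) : R := \sum_(0 <= m < M) inv_sqr m ^+ j.

Lemma inv_sqr_gt0 m : 0 < inv_sqr m.
Proof. by rewrite invr_gt0 exprn_gt0. Qed.

Lemma inv_sqr_le m : inv_sqr m <= 4^-1.
Proof.
rewrite lef_pV2 ?posrE ?exprn_gt0 // -natrX ler_nat.
by rewrite -[4%N]/(2 ^ 2)%N leq_exp2r.
Qed.

Lemma sum_inv_sqr_le M : \sum_(0 <= m < M) inv_sqr m <= 1.
Proof.
suff : \sum_(0 <= m < M) inv_sqr m <= 1 - M.+1%:R^-1 by move/le_trans; apply; rewrite gerBl invr_ge0.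
elim: M => [|M IH]; first by rewrite big_nil invr1 subrr.
rewrite big_nat_recr //=.
have h1 : 0 < M.+1%:R :> R by [].
have h2 : 0 < M.+2%:R :> R by [].
have e : M.+1%:R^-1 - M.+2%:R^-1 = (M.+1%:R * M.+2%:R)^-1 :> R.
  rewrite -[in M.+2%:R](natr1 M.+1); field; rewrite gt_eqF //= natr1 gt_eqF //.
have h : inv_sqr M <= (M.+1%:R * M.+2%:R)^-1.
  by rewrite lef_pV2 ?posrE ?mulr_gt0 ?exprn_gt0 // expr2 ler_wpM2r // ler_nat.
by apply: le_trans (lerD IH h) _; rewrite -e addrA subrK.
Qed.

Lemma zeta_tail_nd j : {homo zeta_tail j : m n / (m <= n)%N >-> m <= n}.
Proof.
apply/nondecreasing_seqP => n; rewrite /zeta_tail big_nat_recr //= lerDl.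
by rewrite exprn_ge0 // ltW ?inv_sqr_gt0.
Qed.

(** One factor 1/m^2 is kept for summability; each of the others is at most 1/4. *)
Lemma zeta_tail_le j M : zeta_tail j.+1 M <= 4^-1 ^+ j.
Proof.
apply: (@le_trans _ _ (\sum_(0 <= m < M) 4^-1 ^+ j * inv_sqr m)).
  apply: ler_sum => m _; rewrite exprSr ler_wpM2r ?(ltW (inv_sqr_gt0 m)) //.
  by rewrite lerXn2r ?nnegrE ?invr_ge0 ?(ltW (inv_sqr_gt0 m)) ?inv_sqr_le.
by rewrite -mulr_sumr ler_piMr ?exprn_ge0 ?invr_ge0 ?sum_inv_sqr_le.
Qed.

Definition kappa (j : nat) : R := theta R j - 2^-1.

Lemma cvg_zeta_tail j : zeta_tail j.+1 @ \oo --> 2 * kappa j.+1.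
Proof.
have tc : cvgn (zeta_tail j.+1).
  apply: nondecreasing_is_cvgn; first exact: zeta_tail_nd.
  by exists (4^-1 ^+ j) => _ [n _ <-]; exact: zeta_tail_le.
suff -> : 2 * kappa j.+1 = limn (zeta_tail j.+1) by [].
rewrite /kappa /theta mulrBr divff ?pnatr_eq0 // mulrCA divff ?pnatr_eq0 // mulr1.
apply/eqP; rewrite subr_eq addrC; apply/eqP; rewrite /zeta.
apply: cvg_lim => //; rewrite -(cvg_shiftn 1).
have -> : (fun n => series (fun m => m.+1%:R `^ (- (2 * j.+1)%:R)) (n + 1)%N) =
    (fun n => 1 + zeta_tail j.+1 n).
  apply/funext => n; rewrite addn1 /series /= big_nat_recl // powR1; congr (_ + _).
  by apply: eq_bigr => m _; rewrite powR_invn // exprM exprVn.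
by apply: cvgD => //; exact: cvg_cst.
Qed.

Lemma kappa_bounds j : 0 <= kappa j.+1 <= 2^-1 * 4^-1 ^+ j.
Proof.
have h := @cvg_zeta_tail j.
have := nondecreasing_cvgn_le (@zeta_tail_nd j.+1) (cvgP _ h) 0%N.
rewrite /zeta_tail big_nil (cvg_lim _ h) // pmulr_rge0 // => -> /=.
rewrite -(ler_pM2l (ltr0n R 2)) mulrA divff ?pnatr_eq0 // mul1r -(cvg_lim _ h) //.
apply: limr_le; first exact: (cvgP _ h).
by near=> n; exact: zeta_tail_le.
Unshelve. all: by end_near. Qed.

(** Mean value theorem for the remainder, whose derivative is y^J / (1 - y). The factor [x] is kept
    so that the bound can be summed over x = 1/m^2. *)
Lemma ln_series_bound (x : R) J : 0 <= x <= 4^-1 ->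
  `|- ln (1 - x) - \sum_(0 <= j < J) x ^+ j.+1 / j.+1%:R| <= 2 * 4^-1 ^+ J * x.
Proof.
move=> /andP[x0 x4].
pose phi (y : R) := - ln (1 - y) - \sum_(0 <= j < J) y ^+ j.+1 / j.+1%:R.
pose dphi (y : R) := y ^+ J / (1 - y).
have sumE (y : R) N : is_derive y 1 (fun z : R => \sum_(0 <= j < N) z ^+ j.+1 / j.+1%:R)
    (\sum_(0 <= j < N) y ^+ j).
  elim: N => [|N IH].
    by under eq_fun do rewrite big_nil; rewrite big_nil; exact: is_derive_cst.
  under eq_fun do rewrite big_nat_recr //=.
  rewrite big_nat_recr //=; apply: is_deriveD.
  have -> : (fun z : R => z ^+ N.+1 / N.+1%:R) = (N.+1%:R^-1 \*: (id ^+ N.+1)).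
    by apply/funext => z; rewrite /= exprfctE [RHS]mulrC.
  apply: is_derive_eq.
  by rewrite /GRing.scale /= mulr1 mulrA mulVf ?mul1r.
have dlnE (y : R) : y < 1 -> is_derive y 1 (fun z : R => - ln (1 - z)) (1 - y)^-1.
  move=> y1; have y0 : 0 < 1 - y by rewrite subr_gt0.
  have h1 : is_derive y 1 (fun z : R => 1 - z) (-1).
    by apply: is_derive_eq; rewrite add0r mul1r.
  have h2 : is_derive y 1 (fun z : R => ln (1 - z)) (- (1 - y)^-1).
    have := @is_derive1_comp _ (@ln R) (fun z => 1 - z) y _ _ (is_derive1_ln y0) h1.
    by rewrite mulrN1.
  by apply: is_derive_eq; rewrite opprK.
have dphiE (y : R) : y <= 4^-1 -> is_derive y 1 phi (dphi y).
  move=> y4; have y1 : 0 < 1 - y by lra.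
  have -> : dphi y = (1 - y)^-1 - \sum_(0 <= j < J) y ^+ j.
    have := subrX1 y J; rewrite -(big_mkord predT (fun i => y ^+ i)) => h.
    rewrite /dphi (_ : y ^+ J = 1 + (y - 1) * \sum_(0 <= j < J) y ^+ j).
      by field; rewrite gt_eqF.
    by rewrite -h addrCA subrr addr0.
  by apply: is_deriveB; apply: dlnE; lra.
have phi0 : phi 0 = 0.
  rewrite /phi subr0 ln1 oppr0 add0r big1 ?oppr0 // => j _.
  by rewrite exprS mul0r mul0r.
have [->|xn0] := eqVneq x 0; first by rewrite -/(phi 0) phi0 normr0 mulr0.
have xp : 0 < x by rewrite lt_neqAle eq_sym xn0.
have le4 (y : R) : y \in `[0, x] -> y <= 4^-1.
  by rewrite in_itv /= => /andP[_ yx]; apply: le_trans x4.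
have [| |y y0x] := @MVT R phi dphi 0 x xp.
- by move=> y y0x; apply: dphiE; apply: le4; exact: subset_itv_oo_cc.
- apply: derivable_within_continuous => y y0x.
  by case: (dphiE y (le4 _ y0x)).
have /le4 y4 := subset_itv_oo_cc y0x.
move: y0x; rewrite in_itv /= => /andP[y0 yx].
rewrite phi0 !subr0 -/(phi x) => ->.
rewrite normrM (ger0_norm x0) ler_wpM2r // /dphi ger0_norm; last first.
  by rewrite divr_ge0 ?exprn_ge0 ?(ltW y0) // subr_ge0; lra.
rewrite ler_pdivrMr; last by lra.
have h : y ^+ J <= 4^-1 ^+ J by rewrite lerXn2r ?nnegrE ?(ltW y0) ?invr_ge0.
have h2 : 0 <= y ^+ J by rewrite exprn_ge0 ?ltW.
nra.
Qed.

(** Telescoping, from 1 - 1/m^2 = (m-1)(m+1)/m^2. The limit ln 2 is the origin of the factor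
    2^(t/2). *)
Lemma sum_ln_inv_sqr M :
  \sum_(0 <= m < M) - ln (1 - inv_sqr m) = ln (2 * M.+1%:R / M.+2%:R).
Proof.
elim: M => [|M IH]; first by rewrite big_nil mulr1 divff ?ln1.
have h1 : 0 < M.+1%:R :> R by [].
have h2 : 0 < M.+2%:R :> R by [].
have h3 : 0 < M.+3%:R :> R by [].
rewrite big_nat_recr //= IH.
have -> : 1 - inv_sqr M = (M.+1%:R * M.+3%:R) / (M.+2%:R * M.+2%:R).
  rewrite /inv_sqr; have -> : M.+1%:R = M.+2%:R - 1 :> R by rewrite -(natr1 M.+1) addrK.
  by rewrite -(natr1 M.+2); field; rewrite gt_eqF.
rewrite -ln_div ?posrE ?divr_gt0 ?mulr_gt0 //; congr ln.
by field; rewrite !nat1r !gt_eqF.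
Qed.

(** The sums over j and m are exchanged on finite rectangles only; the error 2 * 4^(-J) does not
    depend on M, so M may tend to infinity first. *)
Lemma cvg_sum_kappa :
  \sum_(0 <= j < J) kappa j.+1 / j.+1%:R @[J --> \oo] --> (ln 2 / 2 : R).
Proof.
have key J : `|ln 2 - \sum_(0 <= j < J) 2 * kappa j.+1 / j.+1%:R| <= 2 * 4^-1 ^+ J.
  have l1 : ln (2 * M.+1%:R / M.+2%:R) @[M --> \oo] --> (ln 2 : R).
    have h : 2 * (1 - M.+2%:R^-1) @[M --> \oo] --> (2 : R).
      rewrite -[X in _ --> X]mulr1; apply: cvgMl_tmp.
      rewrite -[X in _ --> X]subr0; apply: cvgB; first exact: cvg_cst.
      by have := @cvg_harmonic R; rewrite -(cvg_shiftn 1); under eq_fun do rewrite addn1.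
    have : ln (2 * (1 - M.+2%:R^-1)) @[M --> \oo] --> (ln 2 : R).
      by apply: continuous_cvg h; exact: continuous_ln.
    apply: cvg_trans; apply: near_eq_cvg; near=> M => /=; congr ln.
    have -> : M.+1%:R = M.+2%:R - 1 :> R by rewrite -(natr1 M.+1) addrK.
    by rewrite -mulrA mulrBl divff ?pnatr_eq0 // mul1r.
  have l2 : \sum_(0 <= j < J) zeta_tail j.+1 M / j.+1%:R @[M --> \oo] -->
      \sum_(0 <= j < J) 2 * kappa j.+1 / j.+1%:R.
    apply: (@cvg_sum_nat _ (fun j M => zeta_tail j.+1 M / j.+1%:R)) => j.
    by apply: cvgMr_tmp; exact: cvg_zeta_tail.
  have l3 : `|ln (2 * M.+1%:R / M.+2%:R) - \sum_(0 <= j < J) zeta_tail j.+1 M / j.+1%:R| @[M --> \oo] -->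
      `|ln 2 - \sum_(0 <= j < J) 2 * kappa j.+1 / j.+1%:R|.
    by apply: cvg_norm; exact: cvgB.
  rewrite -(cvg_lim _ l3) //; apply: limr_le; first exact: (cvgP _ l3).
  near=> M; rewrite /= -sum_ln_inv_sqr /zeta_tail.
  rewrite [X in _ - X](eq_bigr (fun j => \sum_(0 <= m < M) inv_sqr m ^+ j.+1 / j.+1%:R)); last first.
    by move=> j _; rewrite mulr_suml.
  rewrite exchange_big /= -sumrB; apply: le_trans (ler_norm_sum _ _ _) _.
  apply: (@le_trans _ _ (\sum_(0 <= m < M) 2 * 4^-1 ^+ J * inv_sqr m)).
    by apply: ler_sum => m _; apply: ln_series_bound; rewrite inv_sqr_le ltW ?inv_sqr_gt0.
  by rewrite -mulr_sumr ler_piMr ?sum_inv_sqr_le // mulr_ge0 ?exprn_ge0 ?invr_ge0.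
have h0 : 2 * 4^-1 ^+ J @[J --> \oo] --> (0 : R).
  rewrite -(mulr0 2); apply: cvgMl_tmp; apply: cvg_expr; rewrite ger0_norm ?invr_ge0 //; lra.
have h1 : (ln 2 - \sum_(0 <= j < J) 2 * kappa j.+1 / j.+1%:R) @[J --> \oo] --> (0 : R).
  apply/cvgr0Pnorm_lt => e e0; near=> J; apply: le_lt_trans (key J) _.
  rewrite -[ltLHS]ger0_norm ?mulr_ge0 ?exprn_ge0 ?invr_ge0 //.
  by near: J; move/cvgr0Pnorm_lt : h0; apply.
have h2 : (ln 2 / 2 - 2^-1 * (ln 2 - \sum_(0 <= j < J) 2 * kappa j.+1 / j.+1%:R)) @[J --> \oo] --> (ln 2 / 2 - 2^-1 * 0 : R).
  by apply: cvgB; [exact: cvg_cst|exact: cvgMl_tmp].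
rewrite mulr0 subr0 in h2; apply: cvg_trans h2; apply: near_eq_cvg; near=> J.
rewrite mulrBr mulr_sumr opprB [2^-1 * ln 2]mulrC addrC subrK; apply: eq_bigr => j _.
by rewrite !mulrA mulVf ?mul1r ?pnatr_eq0.
Unshelve. all: by end_near. Qed.

Definition Kap : fps R := fun j => if j is j'.+1 then kappa j / j%:R else 0.

Lemma Kap_ge0 j : 0 <= Kap j.
Proof. by case: j => //= j; rewrite divr_ge0 //; have /andP[] := kappa_bounds j. Qed.

Lemma cvg_series_Kap : series Kap @ \oo --> (ln 2 / 2 : R).
Proof.
rewrite -(cvg_shiftn 1); apply: cvg_trans cvg_sum_kappa; apply: near_eq_cvg; near=> J.
by rewrite /= addn1 /series /= big_nat_recl // add0r.
Unshelve. all: by end_near. Qed.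

(** The radius 2 lies strictly between the point of evaluation 1 and the radius of convergence 4;
    the resulting gain 2^i later pays for polynomial losses in i. *)
Lemma l1le_scale_Kap : l1le (fps_scale 2 Kap) 2.
Proof.
suff h N : series (fun k => `|fps_scale 2 Kap k|) N.+1 <= 2 - 2 * 2^-1 ^+ N.
  move=> [|N]; first by rewrite /series /= big_nil.
  by apply: le_trans (h N) _; rewrite gerBl mulr_ge0 ?exprn_ge0 ?invr_ge0.
rewrite /series /=; elim: N => [|N IH].
  by rewrite big_nat1 /fps_scale /= mul0r normr0 expr0 mulr1 subrr.
rewrite big_nat_recr //=; have /andP[k0 k4] := kappa_bounds N.
have : `|fps_scale 2 Kap N.+1| <= 2^-1 ^+ N.
  rewrite /fps_scale ger0_norm ?mulr_ge0 ?Kap_ge0 ?exprn_ge0 //=.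
  apply: (@le_trans _ _ (2^-1 * 4^-1 ^+ N * 2 ^+ N.+1)).
    rewrite ler_wpM2r ?exprn_ge0 //; apply: le_trans k4.
    by rewrite ler_pdivrMr // ler_peMr // ler1n.
  rewrite exprS mulrACA mulVf ?pnatr_eq0 // mul1r -exprMn.
  by rewrite (_ : 4^-1 * 2 = 2^-1) //; lra.
rewrite exprS; lra.
Qed.

End ZetaValues.

(** * Coefficients of [exp (t * a z)] and of [(1 - z) ^ (- t / 2)] *)

Section ExpCoefficients.
Variable R : realType.
Implicit Types a b : fps R.

(* [expc a n] is the coefficient of [z ^ n] in [exp (t * a z)], as a power series in [t]. *)
Definition expc a (n : nat) : fps R := fun k => (a ^+ k) n / k`!%:R.

Lemma expcD a b n : expc (a + b) n = \sum_(i < n.+1) expc b i * expc a (n - i)%N.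
Proof.
apply/funext => k; rewrite fps_sum /expc exprDn fps_sum mulr_suml.
under [RHS]eq_bigr do rewrite fpsM.
rewrite exchange_big /=; apply: eq_bigr => m _.
have mk : (m <= k)%N by rewrite -ltnS.
rewrite fpsMn fpsM -(bin_fact mk) -[_ *+ _]mulr_natl mulr_sumr mulr_suml.
rewrite [RHS](reindex_inj rev_ord_inj) /=; apply: eq_bigr => i _.
have iN : (i <= n)%N by rewrite -ltnS.
rewrite subSS subKn // !natrM.
have h1 : 'C(k, m)%:R != 0 :> R by rewrite pnatr_eq0 -lt0n bin_gt0.
have h2 : m`!%:R != 0 :> R by rewrite pnatr_eq0 -lt0n fact_gt0.
have h3 : (k - m)`!%:R != 0 :> R by rewrite pnatr_eq0 -lt0n fact_gt0.
by field; rewrite h1 h2 h3.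
Qed.

Lemma expc_coef0 a n : expc a n 0%N = (n == 0%N)%:R.
Proof. by rewrite /expc expr0 fps1 divr1. Qed.

Lemma expc0S a k : a 0%N = 0 -> expc a 0 k.+1 = 0.
Proof. by move=> a0; rewrite /expc fps_exp0 // mul0r. Qed.

Lemma expc0 a : a 0%N = 0 -> expc a 0 = 1.
Proof.
by move=> a0; apply/funext => -[|k]; rewrite ?expc_coef0 ?expc0S // fps1.
Qed.

Lemma expc_lt a n k : a 0%N = 0 -> (n < k)%N -> expc a n k = 0.
Proof. by move=> a0 nk; rewrite /expc fps_exp_lt // mul0r. Qed.

(** The identity z d/dz exp(t a) = t (z a') exp(t a), read at z^(n+1) t^(k+1). *)
Lemma expc_rec a n k : n.+1%:R * expc a n.+1 k.+1 =
  \sum_(i < n.+1) (i.+1%:R * a i.+1) * expc a (n - i)%N k.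
Proof.
have := congr1 (fun f : fps R => f n.+1) (eulerX a k).
rewrite fpsMn mulrC fpsM big_ord_recl {2}/euler mul0r mul0r add0r {1}/euler => h.
under [RHS]eq_bigr do rewrite /expc mulrA.
rewrite -mulr_suml /expc mulrA h -[X in X / _]mulr_natr factS natrM.
have k0 : k.+1%:R != 0 :> R by rewrite pnatr_eq0.
rewrite invfM -mulrA [X in _ * X]mulrA divff // mul1r; congr (_ / _).
Qed.

End ExpCoefficients.

(** * The series (1 - z)^(-t/2) and its variation in n *)

Section BinomialSeries.
Variable R : realType.

(** The series - log(1 - z) / 2. *)
Definition Lam : fps R := fun j => if j is j'.+1 then (2 * j%:R)^-1 else 0.

Definition fps_lin (x y : R) : fps R := fun k => if k is k'.+1 then y *+ (k' == 0%N) else x.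

(* Coefficient of [z ^ n] in [(1 - z) ^ (- t / 2)]. *)
Definition bin_coef (n : nat) : fps R := expc Lam n.

(* [bin_val s n] is the value of [bin_coef n] at [t = 2 s]. *)
Fixpoint bin_val (s : R) (n : nat) : R :=
  if n is n'.+1 then bin_val s n' * ((n'%:R + s) / n'.+1%:R) else 1.

(** The value at t = 1, which bounds the norm of [bin_coef n] because all factors of the latter have
    non-negative coefficients. *)
Definition bin_mass (n : nat) : R := bin_val 2^-1 n.

Lemma fps_lin_coef0 x y (a : fps R) : (fps_lin x y * a) 0%N = x * a 0%N.
Proof. by rewrite fpsM big_ord1. Qed.

Lemma fps_lin_coefS x y (a : fps R) k : (fps_lin x y * a) k.+1 = x * a k.+1 + y * a k.
Proof.
rewrite fpsM !big_ord_recl big1 ?addr0 /= ?subn0 ?subSS ?subn0 // => i _.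
by rewrite mul0r.
Qed.

Lemma fps_linB x y x' y' : fps_lin x y - fps_lin x' y' = fps_lin (x - x') (y - y').
Proof. by apply/funext => -[|[|k]]; rewrite fpsB //= subrr. Qed.

Lemma fps_lin1 : fps_lin 1 0 = 1.
Proof. by apply/funext => -[|[|k]]; rewrite fps1. Qed.

Lemma l1le_lin x y : l1le (fps_lin x y) (`|x| + `|y|).
Proof.
case=> [|[|N]]; rewrite /series /=.
- by rewrite big_nil addr_ge0.
- by rewrite big_nat1 lerDl.
- by rewrite !big_nat_recl //= big1 ?addr0 // => k _; rewrite normr0.
Qed.

(** Since j * Lam_j = 1/2 for every j >= 1, the recursions [expc_rec] for consecutive n differ by a
    single term. This gives the factor (n + t/2)/(n + 1). *)
Lemma bin_coefS n : bin_coef n.+1 =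
  fps_lin (n%:R / n.+1%:R) (2^-1 / n.+1%:R) * bin_coef n.
Proof.
have n0 : n.+1%:R != 0 :> R by rewrite pnatr_eq0.
apply/funext => -[|k]; rewrite ?fps_lin_coef0 ?fps_lin_coefS /bin_coef.
  rewrite !expc_coef0; case: n {n0} => [|n]; rewrite ?mulr0 // mul0r mul0r //.
apply: (mulfI n0).
rewrite [RHS](_ : _ = n%:R * expc Lam n k.+1 + 2^-1 * expc Lam n k); last first.
  by field; rewrite nat1r.
have S m : m.+1%:R * expc Lam m.+1 k.+1 = \sum_(i < m.+1) 2^-1 * expc Lam (m - i)%N k.
  rewrite expc_rec; apply: eq_bigr => i _; congr (_ * _).
  by rewrite /= invfM mulrCA divff ?mulr1 // pnatr_eq0.
rewrite S big_ord_recl subn0 addrC; congr (_ + _).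
case: n {n0} => [|n]; first by rewrite big_ord0 mul0r.
by rewrite S; apply: eq_bigr => i _; rewrite /= subSS.
Qed.

Lemma bin_coef0 : bin_coef 0 = 1. Proof. exact: expc0. Qed.

Lemma bin_mass_gt0 n : 0 < bin_mass n.
Proof.
rewrite /bin_mass; elim: n => //= n IH; rewrite mulr_gt0 ?divr_gt0 //.
Qed.

Lemma bin_massS_lin n : bin_mass n.+1 = (n%:R / n.+1%:R + 2^-1 / n.+1%:R) * bin_mass n.
Proof. by rewrite /bin_mass /= -mulrDl mulrC. Qed.

Lemma l1le_bin_coef n : l1le (bin_coef n) (bin_mass n).
Proof.
elim: n => [|n IH]; first by rewrite bin_coef0; exact: l1le1.
rewrite bin_coefS bin_massS_lin; apply: l1leM => //.
have := l1le_lin (n%:R / n.+1%:R) (2^-1 / n.+1%:R).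
by rewrite !ger0_norm ?divr_ge0 // ?invr_ge0.
Qed.

(** Used to bound the mass at an earlier index m by (n+1)/(m+1) times the mass at n; this is crude,
    but loses only a power of i + 1 when m >= n - i. *)
Lemma bin_mass_nd m n : (m <= n)%N -> m.+1%:R * bin_mass m <= n.+1%:R * bin_mass n.
Proof.
move: m n; apply: (homo_leq (@lexx _ _) (@le_trans _ _)) => n.
rewrite /bin_mass /= -/(bin_mass n) mulrCA -[leLHS]mulrC ler_wpM2l ?(ltW (bin_mass_gt0 n)) //.
have n0 : (0 : R) < n.+1%:R by [].
rewrite mulrA ler_pdivlMr // -(natr1 n.+1) -(natr1 n).
have := ler0n R n; nra.
Qed.

Lemma l1le_bin_coef_step m : l1le (bin_coef m.+1 - bin_coef m) (3 / 2 / m.+1%:R * bin_mass m).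
Proof.
have m0 : m.+1%:R != 0 :> R by rewrite pnatr_eq0.
rewrite bin_coefS -[X in _ - X]mul1r -fps_lin1 -mulrBl fps_linB; apply: l1leM (l1le_bin_coef m).
(* 3/2 is the norm of t/2 - 1, the numerator of the relative increment. *)
have -> : 3 / 2 / m.+1%:R = `|m%:R / m.+1%:R - 1| + `|2^-1 / m.+1%:R - 0| :> R.
  have -> : m%:R / m.+1%:R - 1 = - m.+1%:R^-1 :> R by rewrite -natr1; field; rewrite natr1.
  rewrite subr0 normrN !ger0_norm ?divr_ge0 ?invr_ge0 //; field; rewrite nat1r //.
exact: l1le_lin.
Qed.

(** There are i steps. In each of them 1/(m+1) and the comparison of masses both cost a factor i +
    1, because (m+1)(i+1) >= n+1 as soon as m >= n - i. So the range of i need not be split. *)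
Lemma l1le_bin_coef_diff n i : (i <= n)%N ->
  l1le (bin_coef n - bin_coef (n - i)) (3 / 2 * i%:R * i.+1%:R ^+ 2 * (bin_mass n / n.+1%:R)).
Proof.
move=> iN; rewrite -telescope_sumr ?leq_subr //.
have step m : (n - i <= m < n)%N ->
    l1le (bin_coef m.+1 - bin_coef m) (3 / 2 * i.+1%:R ^+ 2 * (bin_mass n / n.+1%:R)).
  move=> /andP[im mn]; apply: l1leW (l1le_bin_coef_step m) _.
  have n0 : (0 : R) < n.+1%:R by [].
  have m0 : (0 : R) < m.+1%:R by [].
  have h1 := bin_mass_nd (ltnW mn).
  have h2 : n.+1%:R <= m.+1%:R * i.+1%:R :> R by rewrite -natrM ler_nat; nia.
  have s0 := bin_mass_gt0 n.
  have -> : 3 / 2 / m.+1%:R * bin_mass m = 3 / 2 * (m.+1%:R * bin_mass m / m.+1%:R ^+ 2).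
    by field; rewrite nat1r.
  rewrite -[leRHS]mulrA ler_pM2l // ler_pdivrMr ?exprn_gt0 //; apply: le_trans h1 _.
  have -> : i.+1%:R ^+ 2 * (bin_mass n / n.+1%:R) * m.+1%:R ^+ 2 =
      (m.+1%:R * i.+1%:R) ^+ 2 / n.+1%:R * bin_mass n.
    by field; rewrite nat1r.
  rewrite ler_pM2r // ler_pdivlMr // -expr2 lerXn2r ?nnegrE ?mulr_ge0 //.
rewrite big_nat; have h := @l1le_sum R nat (index_iota (n - i) n) _ _ _ step.
apply: (l1leW h); rewrite -big_nat sumr_const_nat subKn // -[leLHS]mulr_natl.
by rewrite le_eqVlt; apply/orP; left; apply/eqP; ring.
Qed.

End BinomialSeries.

(** * The analytic correction factor *)

Lemma cube_le_exp2 i : (i.+1 ^ 3 <= 27 * 2 ^ i)%N.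
Proof.
elim: i => [|[|[|[|i]]] IH] //.
(* The inequality (m+1)^3 <= 2 m^3 holds from m = 4 on, hence the separate small cases. *)
rewrite (expnS 2); apply: (@leq_trans (2 * i.+4 ^ 3)); last by rewrite mulnCA leq_mul2l.
by rewrite !expnS expn0; nia.
Qed.

Section CorrectionFactor.
Variable R : realType.

Definition corr (i : nat) : fps R := expc (Kap R) i.

(** [corr i] is a polynomial in t of degree at most i, so this partial sum is its full value at t =
    1. *)
Definition corr_mass (i : nat) : R := series (corr i) i.+1.

Lemma corr_ge0 i k : 0 <= corr i k.
Proof.
rewrite divr_ge0 //; elim: k i => [|k IH] i; first by rewrite expr0 fps1.
by rewrite exprS fpsM sumr_ge0 // => j _; rewrite mulr_ge0 ?Kap_ge0.
Qed.

Lemma corr_mass_ge0 i : 0 <= corr_mass i.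
Proof. by rewrite /corr_mass /series /= sumr_ge0 // => k _; exact: corr_ge0. Qed.

Lemma corr_series_le i N : series (corr i) N <= corr_mass i.
Proof.
have [Ni|iN] := leqP N i.+1; rewrite /corr_mass /series /=.
  by rewrite (@big_cat_nat _ _ _ N 0 i.+1) //= lerDl sumr_ge0 // => k _; exact: corr_ge0.
rewrite (@big_cat_nat _ _ _ i.+1 0 N) //= ?(ltnW iN) // [X in _ + X]big_nat [X in _ + X]big1 ?addr0 //.
by move=> k /andP[ik _]; rewrite /corr expc_lt.
Qed.

Lemma l1le_corr i : l1le (corr i) (corr_mass i).
Proof.
move=> N; apply: le_trans (corr_series_le i N).
by apply: ler_sum => k _; rewrite ger0_norm ?corr_ge0.
Qed.

Lemma series_pow_Kap_le k N : \sum_(0 <= i < N) 2 ^+ i * (Kap R ^+ k) i <= 2 ^+ k.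
Proof.
have h := l1leX k (@l1le_scale_Kap R).
apply: le_trans (h N); rewrite -fps_scaleX; apply: ler_sum => i _.
by rewrite mulrC ler_norm.
Qed.

(** The full sum is the correction factor at t = 1, z = 2, that is exp(Kap(2)), and [l1le_scale_Kap]
    bounds the exponent by 2. *)
Lemma sum_corr_mass_le N : \sum_(0 <= i < N) 2 ^+ i * corr_mass i <= expR 2.
Proof.
apply: (@le_trans _ _ (\sum_(0 <= i < N) 2 ^+ i * series (corr i) N)).
  rewrite big_nat [leRHS]big_nat; apply: ler_sum => i /andP[_ iN].
  rewrite ler_wpM2l ?exprn_ge0 // /corr_mass /series /=.
  by rewrite (@big_cat_nat _ _ _ i.+1 0 N) //= lerDl sumr_ge0 // => k _; exact: corr_ge0.
under eq_bigr do rewrite mulr_sumr.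
rewrite exchange_big /=; apply: (@le_trans _ _ (series (exp_coeff 2) N)).
  apply: ler_sum => k _; under eq_bigr do rewrite /corr /expc mulrA.
  rewrite -mulr_suml exp_coeffE mulrC ler_wpM2l ?invr_ge0 //.
  exact: series_pow_Kap_le.
apply: nondecreasing_cvgn_le; last exact: is_cvg_series_exp_coeff.
apply/nondecreasing_seqP => n; rewrite /series /= big_nat_recr //= lerDl.
by rewrite exp_coeffE mulr_ge0 ?exprn_ge0 ?invr_ge0.
Qed.

(** 2^(t/2) is this constant times exp(ln 2 / 2 * (t - 1)), a probability generating function. *)
Definition sqrt2 : R := expR (ln 2 / 2).

(** For the series rescaled by 2, the point z = 1 becomes 1/2 and lies in the open disc required by
    [cvg_pseriesM]. *)
Lemma cvg_sum_corr k : (\sum_(i < n) corr i) k @[n --> \oo] -->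
  (fpsC sqrt2 * poisson (ln 2 / 2)) k.
Proof.
have t1 : `|2^-1| < 1 :> R by rewrite ger0_norm ?invr_ge0 // invf_lt1 // ltr1n.
have h m : pseries (fps_scale 2 (Kap R) ^+ m) 2^-1 @ \oo --> (ln 2 / 2 : R) ^+ m.
  elim: m => [|m IH].
    rewrite !expr0 -(cvg_shiftn 1).
    have -> : (fun n => pseries (1 : fps R) (2^-1 : R) (n + 1)%N) = (fun=> 1); last exact: cvg_cst.
    apply/funext => n; rewrite addn1 /pseries /series /= big_nat_recl // fps1 expr0 mulr1.
    by rewrite big1 ?addr0 // => i _; rewrite fps1 mul0r.
  rewrite !exprS; apply: cvg_pseriesM IH => //.
  - exact: l1le_scale_Kap.
  - exact: (l1leX m (@l1le_scale_Kap R)).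
  - have -> : pseries (fps_scale 2 (Kap R)) 2^-1 = series (Kap R); last exact: cvg_series_Kap.
    apply/funext => n; apply: eq_bigr => i _; rewrite /= /fps_scale -mulrA -exprMn.
    by rewrite mulfV ?pnatr_eq0 // expr1n mulr1.
have -> : (fpsC sqrt2 * poisson (ln 2 / 2)) k = (ln 2 / 2) ^+ k / k`!%:R.
  by rewrite fpsCM /poisson [LHS]mulrA /sqrt2 -expRD subrr expR0 mul1r.
have : pseries (fps_scale 2 (Kap R) ^+ k) 2^-1 n / k`!%:R @[n --> \oo] -->
    ((ln 2 / 2) ^+ k / k`!%:R : R) by apply: cvgMr_tmp; exact: h.
apply: cvg_trans; apply: near_eq_cvg; near=> n.
rewrite fps_sum /pseries /series /= big_mkord mulr_suml; apply: eq_bigr => i _.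
rewrite -fps_scaleX /corr /expc /fps_scale; congr (_ / _).
by rewrite -mulrA -exprMn mulfV ?pnatr_eq0 // expr1n mulr1.
Unshelve. all: by end_near. Qed.

(** For i > n the weight 2^i already exceeds n + 1, so the weighted sum of masses yields the rate
    1/(n+1). *)
Lemma l1le_corr_tail n :
  l1le (fpsC sqrt2 * poisson (ln 2 / 2) - \sum_(i < n.+1) corr i) (expR 2 / n.+1%:R).
Proof.
apply: (@l1le_cvg _ (fun m => \sum_(i < m) corr i - \sum_(i < n.+1) corr i)).
  by move=> k; apply: cvgB; [exact: cvg_sum_corr|exact: cvg_cst].
near=> m; have nm : (n.+1 <= m)%N by near: m; exact: nbhs_infty_ge.
rewrite -!(big_mkord predT corr) (@big_cat_nat _ _ _ n.+1 0 m) //= addrAC subrr add0r.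
have h := @l1le_sum R nat (index_iota n.+1 m) predT corr corr_mass (fun i _ => l1le_corr i).
apply: (l1leW h); rewrite ler_pdivlMr //.
apply: le_trans (sum_corr_mass_le m); rewrite (@big_cat_nat _ _ _ n.+1 0 m) //=.
rewrite ler_wpDl //; first by rewrite sumr_ge0 // => i _; rewrite mulr_ge0 ?exprn_ge0 ?corr_mass_ge0.
rewrite mulr_suml; apply: ler_sum_nat => i /andP[ni _].
rewrite mulrC ler_wpM2r ?corr_mass_ge0 // -natrX ler_nat.
by apply: leq_trans ni (ltnW (ltn_expl _ _)).
Unshelve. all: by end_near. Qed.

Definition Theta : fps R := Lam R + Kap R.

(* Coefficient of [z ^ n] in [prod_(m >= 1) (1 - z / m ^ 2) ^ (- t / 2)]. *)
Definition cyc_coef (n : nat) : fps R := expc Theta n.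

(** In the convolution of [corr i] with [bin_coef (n - i)], the second factor is replaced by
    [bin_coef n] and the sum over i is completed to its limit; the two errors are estimated
    separately. *)
Lemma cyc_coef_approx n :
  l1le (cyc_coef n - fpsC sqrt2 * poisson (ln 2 / 2) * bin_coef R n)
    (42 * expR 2 * (bin_mass R n / n.+1%:R)).
Proof.
pose G := fpsC sqrt2 * poisson (ln 2 / 2); pose S := \sum_(i < n.+1) corr i.
have -> : cyc_coef n - G * bin_coef R n =
    - (\sum_(i < n.+1) corr i * (bin_coef R n - bin_coef R (n - i))) - (G - S) * bin_coef R n.
  rewrite /cyc_coef /Theta expcD.
  under [X in _ = - X - _]eq_bigr do rewrite mulrBr.
  by rewrite sumrB -mulr_suml -/S opprB mulrBl opprB addrA subrK.
have s0 : 0 <= bin_mass R n / n.+1%:R by rewrite divr_ge0 ?(ltW (bin_mass_gt0 _ _)).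
have -> : 42 * expR 2 * (bin_mass R n / n.+1%:R) =
    41 * expR 2 * (bin_mass R n / n.+1%:R) + expR 2 / n.+1%:R * bin_mass R n.
  by field; rewrite nat1r.
apply: l1leB; last by apply: l1leM; [exact: l1le_corr_tail|exact: l1le_bin_coef].
have h := @l1le_sum R 'I_n.+1 (index_enum 'I_n.+1) predT _ _
  (fun i _ => l1leM (l1le_corr i) (@l1le_bin_coef_diff R n i (leq_ord i))).
apply: l1leN; apply: (l1leW h).
(* 41 majorises 3/2 * 27, where i (i+1)^2 <= 27 * 2^i; the tail contributes one more unit to the
   constant 42. *)
apply: (@le_trans _ _ (\sum_(i < n.+1) 2 ^+ i * corr_mass i * (41 * (bin_mass R n / n.+1%:R)))).
  apply: ler_sum => i _; rewrite [2 ^+ i * _]mulrC -[leRHS]mulrA ler_wpM2l ?corr_mass_ge0 //.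
  rewrite [leRHS]mulrA ler_wpM2r //.
  have h1 : i.+1%:R ^+ 3 <= 27 * 2 ^+ i :> R.
    by rewrite -!natrX -natrM ler_nat; exact: cube_le_exp2.
  have h2 : i%:R * i.+1%:R ^+ 2 <= i.+1%:R ^+ 3 :> R.
    by rewrite exprS ler_wpM2r ?exprn_ge0 // ler_nat.
  have h3 : 0 <= 2 ^+ i :> R by rewrite exprn_ge0.
  by rewrite -mulrA; lra.
rewrite -mulr_suml mulrC [leRHS]mulrAC ler_wpM2l ?mulr_ge0 //.
  by exact: ltW (bin_mass_gt0 _ _).
by rewrite -(big_mkord predT (fun i => 2 ^+ i * corr_mass i)) // sum_corr_mass_le.
Qed.

End CorrectionFactor.

(** * The Gamma function *)

Section GammaFunction.
Variable R : realType.
Local Notation mu := (@lebesgue_measure R).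

Definition gamma_fun (a x : R) : R := x `^ a * expR (- x).

(** This is Gamma(a + 1) as an extended real, so that identities and inequalities can be proved
    before finiteness is known. *)
Definition egamma (a : R) : \bar R :=
  (\int[mu]_(x in `]0%R, +oo[) (gamma_fun a x)%:E)%E.

Lemma gamma_fun_ge0 a x : 0 <= gamma_fun a x.
Proof. by rewrite mulr_ge0 ?powR_ge0 ?expR_ge0. Qed.

Lemma measurable_gamma_fun a (D : set R) : measurable_fun D (EFin \o gamma_fun a).
Proof.
apply/measurable_EFinP; apply: measurable_funTS.
apply: measurable_funM; first exact: measurable_powR.
apply: measurableT_comp; first exact: measurable_expR.
exact: oppr_measurable.
Qed.
Hint Resolve measurable_gamma_fun : core.

(** Compact intervals exhausting the half-line, for integration by parts; the end [n.+2] keeps the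
    interval non-degenerate at n = 0. *)
Definition gamma_dom (n : nat) : set R := `[(n.+1%:R^-1 : R), n.+2%:R]%classic.

Lemma gamma_fun_parts (a : R) n : 0 < a ->
  (\int[mu]_(x in gamma_dom n) (gamma_fun a x)%:E =
   (gamma_fun a n.+1%:R^-1 - gamma_fun a n.+2%:R)%R%:E +
   a%:E * \int[mu]_(x in gamma_dom n) (gamma_fun (a - 1) x)%:E)%E.
Proof.
move=> a0.
have n0 : (0 : R) < n.+1%:R^-1 by rewrite invr_gt0.
have ab : (n.+1%:R^-1 : R) < n.+2%:R.
  by rewrite (@le_lt_trans _ _ 1) ?invf_le1 ?ltr1n ?ler1n.
have pos x : x \in `[(n.+1%:R^-1 : R), n.+2%:R] -> 0 < x.
  by rewrite in_itv => /andP[+ _]; apply: lt_le_trans.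
have dp (b x : R) : 0 < x -> derivable (@powR R ^~ b) x 1.
  by move=> x0; apply: derivable_powR; rewrite in_itv /= x0.
have dG (x : R) : is_derive x 1 (fun x => - expR (- x)) (expR (- x)).
  by apply: is_derive_eq; rewrite mulrN1 opprK.
have cpow b x : x \in `[(n.+1%:R^-1 : R), n.+2%:R] -> {for x, continuous (@powR R ^~ b)}.
  by move=> /pos x0; apply: differentiable_continuous; apply/derivable1_diffP/dp.
have cexp (x : R) : {for x, continuous (fun x : R => expR (- x))}.
  by apply: continuous_comp; [exact: opp_continuous|exact: continuous_expR].
have cG (x : R) : {for x, continuous (fun x : R => - expR (- x))}.
  by apply: cvgN; exact: cexp.
have lft : n.+1%:R^-1 \in `[(n.+1%:R^-1 : R), n.+2%:R] by rewrite in_itv /= lexx ltW.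
have rgt : n.+2%:R \in `[(n.+1%:R^-1 : R), n.+2%:R] by rewrite in_itv /= lexx ltW.
have := @integration_by_parts R (@powR R ^~ a) (fun x => - expR (- x))
  (fun x => a * x `^ (a - 1)) (fun x => expR (- x)) _ _ ab.
rewrite /gamma_dom /gamma_fun => ->.
- congr (_%:E + _)%E; first by rewrite !mulrN opprK addrC.
  rewrite -ge0_integralZl ?lee_fin ?(ltW a0) //; last 2 first.
  + exact: measurable_gamma_fun.
  + by move=> x _; rewrite lee_fin gamma_fun_ge0.
  rewrite -[RHS]oppeK; congr (- _)%E; rewrite -integral_ge0N //; last first.
    move=> x _ /=; rewrite -EFinM lee_fin mulr_ge0 ?gamma_fun_ge0 ?(ltW a0) //.
  by apply: eq_integral => x _; rewrite -EFinM -EFinN mulrN mulrA.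
- apply: continuous_in_subspaceT => x /set_mem xab; apply: cvgM; [exact: cvg_cst|exact: cpow].
- split.
  + by move=> x xab; apply: dp; apply: pos; exact: subset_itv_oo_cc.
  + by apply: cvg_at_right_filter; exact: cpow.
  + by apply: cvg_at_left_filter; exact: cpow.
- move=> x xab; apply: powR_derive1; rewrite in_itv /= andbT.
  by apply: pos; exact: subset_itv_oo_cc.
- by apply: continuous_subspaceT => x; exact: cexp.
- split.
  + by move=> x _; case: (dG x).
  + by apply: cvg_at_right_filter; exact: cG.
  + by apply: cvg_at_left_filter; exact: cG.
- by move=> x _; rewrite derive1E derive_val.
Qed.

Lemma gamma_fun_cvg0r a : 0 < a -> gamma_fun a n.+1%:R^-1 @[n --> \oo] --> (0 : R).
Proof.
move=> a0; apply: (@squeeze_cvgr _ _ _ _ (fun=> 0) (fun n => n.+1%:R^-1 `^ a)).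
- near=> n; rewrite gamma_fun_ge0 /= /gamma_fun ler_piMr ?powR_ge0 //.
- exact: cvg_cst.
- have /cvg_at_rightP := powR_cvg0 a0; apply; split=> [n|]; first by rewrite invr_gt0.
  exact: cvg_harmonic.
Unshelve. all: by end_near. Qed.

Lemma gamma_fun_cvg0l a : gamma_fun a n.+2%:R @[n --> \oo] --> (0 : R).
Proof.
(* Since exp(x) >= x^(m+1)/(m+1)! and x^a <= x^m for x >= 1, a bound of order 1/x remains. *)
pose m := (Num.truncn a).+1.
have am : a <= m%:R by apply: ltW; exact: truncnS_gt.
apply: (@squeeze_cvgr _ _ _ _ (fun=> 0) (fun n => m.+1`!%:R * n.+1%:R^-1)).
- near=> n; rewrite gamma_fun_ge0 /= /gamma_fun.
  have n2 : 1 <= (n.+2%:R : R) by rewrite ler1n.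
  rewrite expRN ler_pdivrMr ?expR_gt0 // mulrAC ler_pdivlMr ?ltr0n //.
  apply: (@le_trans _ _ (n.+2%:R ^+ m * n.+2%:R)).
    rewrite ler_pM ?powR_ge0 // ?ler_nat // -powR_mulrn //.
    exact: ler_powR.
  have := @expR_ge1Dxn R n.+2%:R m (ler0n _ _).
  move=> /(le_trans (ler_wpDl ler01 (lexx _))).
  by rewrite ler_pdivrMr ?ltr0n ?fact_gt0 // -exprSr mulrC.
- exact: cvg_cst.
- rewrite -[X in _ --> X](mulr0 (m.+1)`!%:R); apply: cvgMl_tmp; exact: cvg_harmonic.
Unshelve. all: by end_near. Qed.

Lemma cvg_gamma_dom a :
  (\int[mu]_(x in gamma_dom n) (gamma_fun a x)%:E @[n --> \oo] --> egamma a)%E.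
Proof.
have -> : egamma a = (\int[mu]_(x in \bigcup_n gamma_dom n) (gamma_fun a x)%:E)%E.
  congr (integral _ _ _); apply/seteqP; split=> x; rewrite /gamma_dom /= !in_itv /= andbT.
    move=> x0; exists (Num.truncn (x + x^-1)) => //=; rewrite ?in_itv /=.
    have xx := truncnS_gt (x + x^-1).
    have xi : 0 < x^-1 by rewrite invr_gt0.
    apply/andP; split; last by rewrite -natr1; lra.
    rewrite -[leRHS]invrK lef_pV2 ?posrE //; lra.
  by move=> [n _] /=; rewrite in_itv /= => /andP[+ _]; apply: lt_le_trans; rewrite invr_gt0.
apply: ge0_nondecreasing_set_cvg_integral.
- apply/nondecreasing_seqP => n; rewrite subsetEset /gamma_dom => x /=.
  rewrite !in_itv /= => /andP[nx xn]; apply/andP; split.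
    by apply: le_trans nx; rewrite lef_pV2 ?posrE // ler_nat.
  by apply: le_trans xn _; rewrite ler_nat.
- by move=> n; exact: measurable_itv.
- by move=> n; exact: measurable_gamma_fun.
- by move=> n x _; rewrite lee_fin gamma_fun_ge0.
Qed.

Lemma egamma_ge0 a : (0 <= egamma a)%E.
Proof. by apply: integral_ge0 => x _; rewrite lee_fin gamma_fun_ge0. Qed.

Lemma egammaS (a : R) : 0 < a -> (egamma a = a%:E * egamma (a - 1))%E.
Proof.
move=> a0; rewrite -(cvg_lim _ (@cvg_gamma_dom a)) //; apply: cvg_lim => //.
under eq_fun do rewrite gamma_fun_parts //.
rewrite -[(a%:E * _)%E]add0e; apply: cvgeD.
- by rewrite fin_num_adde_defr.
- apply: cvg_EFin; first by near=> n.
  rewrite -(subrr 0); apply: cvgB; first exact: gamma_fun_cvg0r.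
  exact: gamma_fun_cvg0l.
- apply: cvgeZl => //; exact: cvg_gamma_dom.
Unshelve. all: by end_near. Qed.

Lemma egamma0 : egamma 0 = 1%E.
Proof.
rewrite /egamma integral_itv_obnd_cbnd; last first.
  exact: measurable_gamma_fun.
have -> : (1 = 0%:E - (- expR (- 0))%R%:E :> \bar R)%E.
  by rewrite oppr0 expR0 -EFinB opprK add0r.
have dG (x : R) : is_derive x 1 (fun x => - expR (- x)) (expR (- x)).
  by apply: is_derive_eq; rewrite mulrN1 opprK.
rewrite (_ : (fun x => (gamma_fun 0 x)%:E) = (fun x => (expR (- x))%:E)); last first.
  by apply/funext => x; rewrite /gamma_fun powRr0 mul1r.
have cexp (x : R) : {for x, continuous (fun x : R => expR (- x))}.
  by apply: continuous_comp; [exact: opp_continuous|exact: continuous_expR].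
apply: (@ge0_continuous_FTC2y _ _ (fun x => - expR (- x))).
- by move=> x _; exact: expR_ge0.
- by apply: continuous_subspaceT => x; exact: cexp.
- rewrite -oppr0; apply: cvgN; exact: cvgr_expR.
- by move=> x _; case: (dG x).
- by apply: cvg_at_right_filter; apply: cvgN; exact: cexp.
- by move=> x _; rewrite derive1E derive_val.
Qed.

(** The right-hand side is the tangent at [y] of the concave function x^s. With v = ln(x/y) the
    claim is e^(sv) <= (1-s) + s e^v, a combination with weights s and 1 - s of two instances of e^u
    >= 1 + u. *)
Lemma powR_le_chord (x y s : R) : 0 <= x -> 0 < y -> 0 <= s <= 1 ->
  x `^ s <= y `^ s * ((1 - s) + s / y * x).
Proof.
move=> x0 y0 /andP[s0 s1]; have [->|xn0] := eqVneq x 0.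
  rewrite mulr0 addr0; have [->|sn0] := eqVneq s 0; first by rewrite !powRr0 subr0 mulr1.
  by rewrite powR0 // mulr_ge0 ?powR_ge0 // subr_ge0.
have {xn0}x0 : 0 < x by rewrite lt_neqAle eq_sym xn0.
set v := ln (x / y).
have xv : x = y * expR v by rewrite lnK ?posrE ?divr_gt0 // mulrCA divff ?mulr1 // gt_eqF.
have -> : x `^ s = y `^ s * expR (s * v).
  by rewrite {1}xv powRM ?expR_ge0 ?(ltW y0) // -expRM (mulrC v).
rewrite ler_pM2l ?powR_gt0 //.
have -> : s / y * x = s * expR v by rewrite xv mulrA divfK // gt_eqF.
have e0 := expR_gt0 (s * v).
have h1 : expR (s * v) * (1 + (1 - s) * v) <= expR v.
  rewrite [leRHS](_ : _ = expR (s * v + (1 - s) * v)); last by congr expR; ring.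
  by rewrite expRD ler_pM2l // expR_ge1Dx.
have h2 : expR (s * v) * (1 - s * v) <= 1.
  rewrite -[leRHS]expR0 -(subrr (s * v)) expRD ler_pM2l //.
  exact: expR_ge1Dx.
have := lerD (ler_wpM2l s0 h1) (ler_wpM2l (_ : 0 <= 1 - s) h2).
rewrite subr_ge0 => /(_ s1) h; apply: le_trans (le_trans _ h) _; last by lra.
by rewrite le_eqVlt; apply/orP; left; apply/eqP; ring.
Qed.

(** The tangent bound integrated against x^a e^(-x); it replaces log-convexity of Gamma. The point
    of tangency [y] is left free and is optimised in [GammaD_le]. *)
Lemma egammaD_le (a y s : R) : 0 < y -> 0 <= s <= 1 ->
  (egamma (a + s) <= (y `^ s)%:E *
     ((1 - s)%:E * egamma a + (s / y)%:E * egamma (a + 1)))%E.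
Proof.
move=> y0 s01; have /andP[s0 s1] := s01.
have c1 : 0 <= y `^ s * (1 - s) by rewrite mulr_ge0 ?powR_ge0 ?subr_ge0.
have c2 : 0 <= y `^ s * (s / y) by rewrite mulr_ge0 ?powR_ge0 ?divr_ge0 ?(ltW y0).
rewrite ge0_muleDr ?mule_ge0 ?egamma_ge0 ?lee_fin ?subr_ge0 ?divr_ge0 ?(ltW y0) //.
rewrite !muleA -!EFinM /egamma -!ge0_integralZl ?lee_fin //; last 4 first.
- exact: measurable_gamma_fun.
- by move=> x _; rewrite lee_fin gamma_fun_ge0.
- exact: measurable_gamma_fun.
- by move=> x _; rewrite lee_fin gamma_fun_ge0.
rewrite -ge0_integralD //; last 4 first.
- by move=> x _; rewrite -EFinM lee_fin mulr_ge0 ?gamma_fun_ge0.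
- by apply: measurable_funeM; exact: measurable_gamma_fun.
- by move=> x _; rewrite -EFinM lee_fin mulr_ge0 ?gamma_fun_ge0.
- by apply: measurable_funeM; exact: measurable_gamma_fun.
apply: ge0_le_integral => //.
- by move=> x _; rewrite lee_fin gamma_fun_ge0.
- exact: measurable_gamma_fun.
- by apply: emeasurable_funD; apply: measurable_funeM; exact: measurable_gamma_fun.
move=> x /=; rewrite in_itv /= andbT => x0.
rewrite -!EFinM -EFinD lee_fin /gamma_fun.
rewrite !powRD ?(gt_eqF x0) ?implybT // (powRr1 (ltW x0)).
have h := ler_wpM2l (gamma_fun_ge0 a x) (powR_le_chord (ltW x0) y0 s01).
rewrite /gamma_fun in h.
by apply: le_trans (le_trans _ h) _; rewrite le_eqVlt; apply/orP; left; apply/eqP; ring.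
Qed.

Lemma egamma_nat n : egamma n%:R = (n`!%:R)%:E.
Proof.
elim: n => [|n IH]; first by rewrite egamma0.
by rewrite egammaS // -[in (_ - 1)%R]natr1 addrK IH -EFinM factS natrM.
Qed.

(** For a >= 0 the bound at y = 1 compares with factorials; for -1 < a < 0 the functional equation
    pulls finiteness back from a + 1. *)
Lemma egamma_fin_num a : -1 < a -> egamma a \is a fin_num.
Proof.
have pos b : 0 <= b -> egamma b \is a fin_num.
  move=> b0; rewrite ge0_fin_numE ?egamma_ge0 //.
  have tb : (Num.truncn b)%:R <= b by rewrite truncn_le.
  have bt := truncnS_gt b; rewrite -natr1 in bt.
  have := @egammaD_le (Num.truncn b)%:R 1 (b - (Num.truncn b)%:R) ltr01.
  rewrite subrKC natr1 !egamma_nat -!EFinM => h; apply: le_lt_trans (h _) (ltry _).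
  by rewrite subr_ge0 tb /= lerBlDl ltW.
move=> a1; have [/pos //|a0] := leP 0 a.
have a10 : 0 < a + 1 by rewrite -ltrBlDr sub0r.
have := egammaS a10; rewrite addrK => e; have := pos _ (ltW a10); rewrite e.
by move: (egamma_ge0 a); case: (egamma a) => [r| |] //; rewrite gt0_muley ?lte_fin.
Qed.

Lemma Gamma_egamma s : Gamma s = fine (egamma (s - 1)).
Proof. by []. Qed.

Lemma GammaE s : 0 < s -> egamma (s - 1) = (Gamma s)%:E.
Proof. by move=> s0; rewrite Gamma_egamma fineK // egamma_fin_num // ltrBrDl subrr. Qed.

Lemma GammaS (s : R) : 0 < s -> Gamma (s + 1) = s * Gamma s.
Proof.
move=> s0; apply: EFin_inj; rewrite EFinM -!GammaE ?addr_gt0 //.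
by rewrite addrK egammaS.
Qed.

Lemma Gamma_nat n : Gamma n.+1%:R = n`!%:R :> R.
Proof. by apply: EFin_inj; rewrite -GammaE // -natr1 addrK egamma_nat. Qed.

Lemma GammaD_le (y s : R) : 0 < y -> 0 <= s <= 1 -> Gamma (y + s) <= y `^ s * Gamma y.
Proof.
move=> y0 s01; have /andP[s0 s1] := s01.
rewrite -lee_fin -GammaE ?ltr_wpDr // addrAC.
apply: le_trans (egammaD_le _ y0 s01) _.
rewrite subrK GammaE // -[y in egamma y](addrK 1) GammaE ?addr_gt0 // GammaS //.
rewrite -!EFinM lee_fin mulrA divfK ?gt_eqF // -mulrDl subrK mul1r.
exact: lexx.
Qed.

(** [GammaD_le] bounds a factorial by a positive multiple of Gamma(s), so no lower estimate of the
    integral is required. *)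
Lemma Gamma_gt0 (s : R) : 0 < s -> 0 < Gamma s.
Proof.
move=> s0; have t0 : 0 <= (Num.truncn s).+1%:R - s <= 1.
  rewrite subr_ge0 (ltW (truncnS_gt s)) /= -natr1 lerBlDl lerD2r.
  by rewrite truncn_le ltW.
have := GammaD_le s0 t0; rewrite subrKC Gamma_nat => /(lt_le_trans _) h.
have := h 0; rewrite ltr0n fact_gt0 => /(_ isT).
by rewrite pmulr_rgt0 // powR_gt0.
Qed.

(** Wendel's argument: [GammaD_le] from n+1 to n+1+s gives the upper bound, and from n+1+s to n+2
    the lower one. *)
Lemma Gamma_bounds (s : R) n : 0 <= s <= 1 ->
  n.+1%:R / (n.+1%:R + s) <= Gamma (n.+1%:R + s) / (n.+1%:R `^ s * n`!%:R) <= 1.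
Proof.
move=> /andP[s0 s1].
have d0 : 0 < n.+1%:R `^ s * n`!%:R :> R by rewrite mulr_gt0 ?powR_gt0 ?ltr0n ?fact_gt0.
have ns0 : 0 < n.+1%:R + s :> R by rewrite ltr_wpDr.
apply/andP; split; last first.
  by rewrite ler_pdivrMr // mul1r -Gamma_nat GammaD_le ?s0.
rewrite ler_pdivlMr //.
have := @GammaD_le (n.+1%:R + s) (1 - s) ns0.
rewrite subr_ge0 s1 lerBlDl lerDr s0 => /(_ isT).
rewrite -addrA subrKC natr1 Gamma_nat => h.
have h2 : (n.+1%:R / (n.+1%:R + s)) `^ (1 - s) * (n.+1`!%:R) <= n.+1%:R `^ (1 - s) * Gamma (n.+1%:R + s).
  rewrite powRM ?invr_ge0 ?(ltW ns0) // -mulrA ler_pM2l ?powR_gt0 //.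
  rewrite -[X in X `^ _](powR_inv1 (ltW ns0)) -powRrM mulN1r powRN.
  by rewrite ler_pdivrMl ?powR_gt0.
have q01 : 0 < n.+1%:R / (n.+1%:R + s) <= 1.
  by rewrite divr_gt0 //= ler_pdivrMr // mul1r lerDl.
have h3 : n.+1%:R / (n.+1%:R + s) <= (n.+1%:R / (n.+1%:R + s)) `^ (1 - s).
  by apply: ger1_powR => //; rewrite lerBlDl lerDr.
rewrite -(ler_pM2l (_ : 0 < n.+1%:R `^ (1 - s))) ?powR_gt0 //; apply: le_trans h2.
have <- : n.+1%:R `^ (1 - s) * (n.+1%:R `^ s * n`!%:R) = n.+1`!%:R :> R.
  by rewrite mulrA -powRD ?subrK ?powRr1 ?factS ?natrM // pnatr_eq0 implybT.
by rewrite mulrCA ler_wpM2r // mulr_ge0 ?powR_ge0 ?(ltW d0).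
Qed.

(** Negative s is included because t runs through a two-sided neighbourhood of 0; it is reduced to s
    + 1 by the functional equation. *)
Lemma Gamma_equiv (s : R) : -1 < s <= 1 ->
  Gamma (n.+1%:R + s) / (n.+1%:R `^ s * n`!%:R) @[n --> \oo] --> (1 : R).
Proof.
have lim1 (t : R) : n.+1%:R / (n.+1%:R + t) @[n --> \oo] --> (1 : R).
  have h : (n.+1%:R^-1 : R) @[n --> \oo] --> (0 : R) by exact: cvg_harmonic.
  have : (1 + t * n.+1%:R^-1)^-1 @[n --> \oo] --> (1 : R).
    rewrite -[X in _ --> X]invr1; apply: cvgV; first exact: oner_neq0.
    rewrite -[X in _ --> X]addr0 -[X in _ + X](mulr0 t).
    by apply: cvgD; [exact: cvg_cst|exact: cvgMl_tmp].
  apply: cvg_trans; apply: near_eq_cvg; near=> n.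
  have n0 : (n.+1%:R : R) != 0 by rewrite pnatr_eq0.
  by rewrite -[X in X + _](divff n0) -mulrDl invfM invrK mulrC.
have pos (t : R) : 0 <= t <= 1 ->
    Gamma (n.+1%:R + t) / (n.+1%:R `^ t * n`!%:R) @[n --> \oo] --> (1 : R).
  move=> t01; apply: (@squeeze_cvgr _ _ _ _
    (fun n => n.+1%:R / (n.+1%:R + t)) (fun=> 1)); [|exact: lim1|exact: cvg_cst].
  by near=> n; exact: Gamma_bounds.
move=> /andP[s1 s1']; have [s0|s0] := leP 0 s; first by apply: pos; rewrite s0.
have sp : 0 <= s + 1 <= 1 by apply/andP; split; lra.
have h := cvgM (pos _ sp) (lim1 s); rewrite mulr1 in h; apply: (cvg_trans _ (h _)).
apply: near_eq_cvg; near=> n => /=.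
have ns : 0 < n.+1%:R + s :> R by rewrite -natr1; have := ler0n R n; lra.
have p0 := @powR_gt0 R n.+1%:R s (ltr0Sn _ _).
have f0 : (0 : R) < n`!%:R by rewrite ltr0n fact_gt0.
have n0 : (0 : R) < n.+1%:R by [].
rewrite addrA (GammaS ns) powRD ?(gt_eqF n0) ?implybT // (powRr1 (ltW n0)).
by field; rewrite !gt_eqF // nat1r.
Unshelve. all: by end_near. Qed.

End GammaFunction.

(** * Poisson approximation *)

Section BernoulliPoisson.
Variable R : realType.

Definition bernoulli_fps (x : R) : fps R := fps_lin (1 - x) x.

Lemma cvg_series_poisson (c : R) : series (poisson c) @ \oo --> (1 : R).
Proof.
have := @cvg_pseries_poisson R c 1; rewrite subrr mulr0 expR0.
rewrite (_ : pseries _ _ = series (poisson c)) //; apply/funext => n.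
by apply: eq_bigr => k _; rewrite /= expr1n mulr1.
Qed.

(** The Poisson series is cut after its linear part. The tail has norm 1 - (1 + d) e^(-d) <= d^2,
    and each of the two remaining coefficients is off by at most |x - d| + d^2. *)
Lemma l1le_bernoulli_poisson (x d : R) : 0 <= d ->
  l1le (bernoulli_fps x - poisson d) (2 * `|x - d| + 3 * d ^+ 2).
Proof.
move=> d0; pose e := expR (- d).
have e0 : 0 <= e by exact: expR_ge0.
have e1 : 1 - d <= e by exact: expR_ge1Dx.
have e2 : e * (1 + d) <= 1.
  rewrite /e expRN mulrC ler_pdivrMr ?expR_gt0 // mul1r; exact: expR_ge1Dx.
have e3 : e <= 1 - d + d ^+ 2 by nra.
pose tail : fps R := poisson d - fps_lin e (e * d).
have tailE k : tail k = if (k < 2)%N then 0 else poisson d k.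
  rewrite /tail fpsB; case: k => [|[|k]] /=; rewrite /poisson -/e ?expr0 ?expr1 ?divr1 ?mulr1 ?subrr //.
  by rewrite mulr0n subr0.
have tail_le : l1le tail (d ^+ 2).
  apply: (@l1leW _ _ (1 - (e + e * d))); last by nra.
  apply: l1le_nneg => [k|]; first by rewrite tailE; case: ifP => // _; exact: poisson_ge0.
  have : (series (poisson d) n - (e + e * d)) @[n --> \oo] --> 1 - (e + e * d).
    by apply: cvgB; [exact: cvg_series_poisson|exact: cvg_cst].
  apply: cvg_trans; apply: near_eq_cvg; near=> n.
  have n2 : (2 <= n)%N by near: n; exact: nbhs_infty_ge.
  have -> : n = n.-2.+2 by lia.
  rewrite /series /= /tail.
  under [RHS]eq_bigr do rewrite fpsB.
  rewrite sumrB; congr (_ - _).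
  by rewrite !big_nat_recl //= big1 ?addr0 // => k _; rewrite mulr0n.
have -> : bernoulli_fps x - poisson d = fps_lin (1 - x - e) (x - e * d) - tail.
  by rewrite /tail /bernoulli_fps -fps_linB opprB addrA subrK.
apply: (l1leW (l1leB (l1le_lin _ _) tail_le)).
have a1 : `|1 - x - e| <= `|x - d| + d ^+ 2.
  have -> : 1 - x - e = (d - x) + (1 - d - e) by ring.
  apply: le_trans (ler_normD _ _) _; rewrite distrC lerD2l ler_norml; apply/andP; split; lra.
have a2 : `|x - e * d| <= `|x - d| + d ^+ 2.
  have -> : x - e * d = (x - d) + d * (1 - e) by ring.
  apply: le_trans (ler_normD _ _) _; rewrite lerD2l ler_norml; apply/andP; split; nra.
lra.
Unshelve. all: by end_near. Qed.

Definition half_log_step (N : nat) : R := ln (N.+1%:R / N%:R) / 2.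

Lemma half_log_step_bounds N : (0 < N)%N ->
  (2 * N.+1%:R)^-1 <= half_log_step N <= (2 * N%:R)^-1.
Proof.
move=> N0; have n0 : (0 : R) < N%:R by rewrite ltr0n.
have n1 : (0 : R) < N.+1%:R by [].
have q0 : (0 : R) < N.+1%:R / N%:R by rewrite divr_gt0.
rewrite /half_log_step !invfM [2^-1 * _]mulrC [2^-1 * _]mulrC !ler_pM2r ?invr_gt0 //; apply/andP; split.
  have -> : ln (N.+1%:R / N%:R) = - ln (1 + - N.+1%:R^-1) :> R.
    have -> : 1 + - N.+1%:R^-1 = N%:R / N.+1%:R :> R.
      by rewrite -natr1; field; rewrite natr1 gt_eqF.
    by rewrite -lnV ?posrE ?divr_gt0 // invf_div.
  rewrite lerNr; apply: le_ln1Dx; rewrite ltrN2 invf_lt1 // ltr1n //.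
have -> : N.+1%:R / N%:R = 1 + N%:R^-1 :> R by rewrite -natr1; field; rewrite gt_eqF.
by apply: le_ln1Dx; rewrite (@lt_trans _ _ 0) ?invr_gt0.
Qed.

(** The factor (N + t/2)/(N + 1), normalised to be 1 at t = 1, equals 1 - x + x t with this x. *)
Definition bin_step (N : nat) : R := 2^-1 / (N%:R + 2^-1).

(** Both parameters lie between 1/(2(N+1)) and 1/(2N), so they differ by O(1/N^2). The inverse
    Poisson factor costs only e^(2d) = (N+1)/N <= 2. *)
Lemma l1le_log_step N : (0 < N)%N ->
  l1le (poisson (- half_log_step N) * bernoulli_fps (bin_step N) - 1) (4 / N%:R ^+ 2).
Proof.
move=> N0; have n0 : (0 : R) < N%:R by rewrite ltr0n.
have n1 : (1 : R) <= N%:R by rewrite ler1n.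
set d := half_log_step N; set x := bin_step N.
have /andP[d1 d2] := half_log_step_bounds N0; rewrite -/d in d1 d2.
have d0 : 0 <= d by apply: le_trans d1; rewrite invr_ge0.
have -> : poisson (- d) * bernoulli_fps x - 1 = poisson (- d) * (bernoulli_fps x - poisson d).
  by rewrite mulrBr -poissonD addNr poisson0.
have e2 : expR (2 * d) <= 2.
  have -> : 2 * d = ln (N.+1%:R / N%:R) by rewrite /d /half_log_step mulrCA divff ?mulr1.
  rewrite lnK ?posrE ?divr_gt0 // ler_pdivrMr // -natr1; lra.
have nn : 0 < N%:R * N.+1%:R :> R by rewrite mulr_gt0.
have xd : `|x - d| <= (2 * N%:R ^+ 2)^-1.
  have x2 : x <= (2 * N%:R)^-1.
    rewrite /x /bin_step invfM ler_pM2l ?invr_gt0 // lef_pV2 ?posrE //; lra.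
  have x1 : (2 * N.+1%:R)^-1 <= x.
    rewrite /x /bin_step invfM ler_pM2l ?invr_gt0 // lef_pV2 ?posrE //; rewrite -(natr1 N); lra.
  have -> : (2 * N%:R ^+ 2)^-1 = (2 * N%:R)^-1 - (2 * N.+1%:R)^-1 + (2 * N%:R ^+ 2 * N.+1%:R)^-1 :> R.
    have q : N%:R + 1 != 0 :> R by rewrite natr1.
    by rewrite -(natr1 N); field; rewrite q gt_eqF.
  have : 0 <= (2 * N%:R ^+ 2 * N.+1%:R)^-1 :> R by rewrite invr_ge0 !mulr_ge0 ?exprn_ge0.
  move: x1 x2 d1 d2; move: (_^-1) (_^-1) (_^-1) => r v u x1 x2 d1 d2 h.
  rewrite ler_norml; apply/andP; split; lra.
have dd : d ^+ 2 <= (4 * N%:R ^+ 2)^-1.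
  have -> : (4 * N%:R ^+ 2)^-1 = (2 * N%:R)^-1 ^+ 2 :> R by field; rewrite gt_eqF.
  by rewrite lerXn2r ?nnegrE // invr_ge0 mulr_ge0.
apply: (l1leW (l1leM (l1le_poissonN d0) (l1le_bernoulli_poisson x d0))).
have -> : 4 / N%:R ^+ 2 = 2 * (2 * (N%:R ^+ 2)^-1) :> R by rewrite mulrA; congr (_ / _); ring.
apply: ler_pM => //.
  by rewrite addr_ge0 // mulr_ge0 // exprn_ge0.
have -> : 2 * (N%:R ^+ 2)^-1 = 2 * (2 * N%:R ^+ 2)^-1 + 4 * (4 * N%:R ^+ 2)^-1 :> R.
  by field; rewrite gt_eqF.
have : 0 <= (4 * N%:R ^+ 2)^-1 :> R by rewrite invr_ge0 mulr_ge0 ?exprn_ge0.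
lra.
Qed.

End BernoulliPoisson.

(** * The limit law *)

Section LimitLaw.
Variable R : realType.

Definition bin_law (N : nat) : fps R := fpsC (bin_mass R N)^-1 * bin_coef R N.

Lemma l1le_bin_law N : l1le (bin_law N) 1.
Proof.
have := l1leC (bin_mass R N)^-1 (@l1le_bin_coef R N).
have h := bin_mass_gt0 R N.
by rewrite ger0_norm ?invr_ge0 ?(ltW h) // mulVf // gt_eqF.
Qed.

Lemma bin_lawS N : bin_law N.+1 = bin_law N * bernoulli_fps (bin_step R N).
Proof.
have h := bin_mass_gt0 R N; have h' := bin_mass_gt0 R N.+1.
have n0 : (0 : R) < N%:R + 2^-1 by rewrite ltr_wpDl // invr_gt0.
have q : N.+1%:R != 0 :> R by rewrite pnatr_eq0.
have p : N%:R * 2 + 1 != 0 :> R by rewrite gt_eqF //; lra.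
have e : (N%:R / N.+1%:R + 2^-1 / N.+1%:R)^-1 = N.+1%:R / (N%:R + 2^-1) :> R.
  by rewrite -mulrDl invf_div.
rewrite /bin_law bin_coefS bin_massS_lin [RHS]mulrC invfM e.
apply/funext => -[|k]; rewrite ?fpsCM ?fps_lin_coef0 ?fps_lin_coefS ?fpsCM /bin_step.
all: by field; rewrite nat1r q p gt_eqF.
Qed.

(* [interp n N] is the law [bin_law N], with its Poissonian part rescaled from [N] to [n]. *)
Definition interp (n N : nat) : fps R :=
  poisson (ln (n%:R / N%:R) / 2) * poisson (ln 2 / 2) * bin_law N.

Lemma interp_diag n : (0 < n)%N -> interp n n = poisson (ln 2 / 2) * bin_law n.
Proof.
by move=> n0; rewrite /interp divff ?pnatr_eq0 -?lt0n // ln1 mul0r poisson0 mul1r.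
Qed.

Lemma interpS n N : (0 < n)%N -> (0 < N)%N ->
  interp n N.+1 = interp n N * (poisson (- half_log_step R N) * bernoulli_fps (bin_step R N)).
Proof.
move=> n0 N0; have n1 : (0 : R) < n%:R by rewrite ltr0n.
have N1 : (0 : R) < N%:R by rewrite ltr0n.
rewrite /interp bin_lawS.
have -> : ln (n%:R / N.+1%:R) / 2 = ln (n%:R / N%:R) / 2 + - half_log_step R N.
  by rewrite /half_log_step !ln_div ?posrE //; field.
by rewrite poissonD; ring.
Qed.

(** The bound 2 and the bound on differences support each other, hence the strong induction. A step
    costs at most 2 * 4/K^2, dominated by the telescoping 8 (1/(K-1) - 1/K); from n = 9 on the total
    is at most 1, to be added to the norm at most 1 of [interp n n]. *)
Lemma l1le_interp_diff n N : (9 <= n)%N -> (n <= N)%N ->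
  l1le (interp n N) 2 /\
  forall M, (N <= M)%N ->
    l1le (interp n M - interp n N) (8 * ((N%:R - 1)^-1 - (M%:R - 1)^-1)).
Proof.
move=> n9.
have n1 (K : nat) : (n <= K)%N -> (1 : R) < K%:R by move=> nK; rewrite ltr1n; lia.
have step K : (n <= K)%N -> l1le (interp n K) 2 ->
    l1le (interp n K.+1 - interp n K) (8 * ((K%:R - 1)^-1 - (K.+1%:R - 1)^-1)).
  move=> nK h; have K0 : (0 < K)%N by lia.
  rewrite interpS //; last by lia.
  rewrite -[X in _ - X]mulr1 -mulrBr; apply: (l1leW (l1leM h (l1le_log_step R K0))).
  have K1 := n1 _ nK; rewrite -(natr1 K) addrK.
  have -> : (K%:R - 1)^-1 - K%:R^-1 = (K%:R * (K%:R - 1))^-1 :> R.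
    by field; rewrite !gt_eqF // ?subr_gt0 //; lra.
  have -> : 2 * (4 / K%:R ^+ 2) = 8 * (K%:R ^+ 2)^-1 :> R by field; rewrite gt_eqF //; lra.
  rewrite ler_pM2l // lef_pV2 ?posrE ?exprn_gt0 ?mulr_gt0 ?subr_gt0 //; try lra.
have tele N0 d : (n <= N0)%N -> (forall K, (N0 <= K < N0 + d)%N -> l1le (interp n K) 2) ->
    l1le (interp n (N0 + d) - interp n N0) (8 * ((N0%:R - 1)^-1 - ((N0 + d)%:R - 1)^-1)).
  move=> nN; elim: d => [|d IH] h.
    by rewrite addn0 !subrr mulr0; exact: l1le0.
  rewrite addnS.
  have -> : interp n (N0 + d).+1 - interp n N0 =
      (interp n (N0 + d).+1 - interp n (N0 + d)) + (interp n (N0 + d) - interp n N0).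
    by rewrite addrA subrK.
  apply: (@l1leW _ _ (8 * (((N0 + d)%:R - 1)^-1 - ((N0 + d).+1%:R - 1)^-1) +
     8 * ((N0%:R - 1)^-1 - ((N0 + d)%:R - 1)^-1))); last by rewrite -mulrDr addrC addrA subrK.
  apply: l1leD; first by apply: step; [lia|apply: h; lia].
  by apply: IH => K /andP[K1 K2]; apply: h; lia.
have bounded K : (n <= K)%N -> l1le (interp n K) 2.
  elim/ltn_ind: K => K IH nK.
  have h := tele n (K - n)%N (leqnn n).
  rewrite subnKC // in h.
  rewrite -[interp n K](subrK (interp n n)).
  apply: (@l1leW _ _ (8 * ((n%:R - 1)^-1 - (K%:R - 1)^-1) + 1)).
    apply: l1leD; first by apply: h => m /andP[m1 m2]; apply: IH.
    rewrite interp_diag; last by lia.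
    rewrite -[X in l1le _ X]mulr1; apply: l1leM; last exact: l1le_bin_law.
    by apply: l1le_poisson; rewrite divr_ge0 // ln_ge0 // ler1n.
  have n8 : (8 : R) <= n%:R - 1 by rewrite lerBrDr natr1 ler_nat.
  have : 8 * (n%:R - 1)^-1 <= 1 :> R by rewrite ler_pdivrMr ?mul1r //; lra.
  have : 0 <= (K%:R - 1)^-1 :> R by rewrite invr_ge0; have := n1 _ nK; lra.
  lra.
move=> nN; split=> [|M NM]; first exact: bounded.
by rewrite -(subnKC NM); apply: tele => // K /andP[K1 _]; apply: bounded; lia.
Qed.

Lemma cvg_gap : 8 * (N%:R - 1)^-1 @[N --> \oo] --> (0 : R).
Proof.
rewrite -(mulr0 8); apply: cvgMl_tmp; rewrite -(cvg_shiftn 2).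
have := @cvg_harmonic R; apply: cvg_trans; apply: near_eq_cvg; near=> N.
by rewrite /harmonic /= addn2 -(natr1 N.+1) addrK.
Unshelve. all: by end_near. Qed.

Definition interp_lim (n : nat) : fps R := fun k => limn (fun N => interp n N k).

Lemma cvg_interp n k : (9 <= n)%N -> interp n N k @[N --> \oo] --> interp_lim n k.
Proof.
move=> n9; rewrite /interp_lim.
have h0 := cvg_gap.
(* Adding the bound 8/(N-1) on the remaining variation makes the coefficient sequence nonincreasing,
   so monotone convergence applies. *)
pose v N := interp n (N + n)%N k + 8 * ((N + n)%:R - 1)^-1.
have vd : {homo v : N M / (N <= M)%N >-> M <= N}.
  move=> N M NM; rewrite /v.
  have [_ h] := l1le_interp_diff n9 (leq_addl N n).
  have := l1le_coef k (h (M + n)%N _); rewrite leq_add2r => /(_ NM).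
  rewrite fpsB ler_norml mulrBr => /andP[_].
  by rewrite lerBlDr => h2; rewrite -lerBrDr; apply: le_trans h2 _; lra.
have vb : has_lbound (range v).
  exists (-2) => _ [N _ <-]; rewrite /v.
  have [h _] := l1le_interp_diff n9 (leq_addl N n).
  have := l1le_coef k h; rewrite ler_norml => /andP[h1 _].
  rewrite -[-2]addr0 lerD // mulr_ge0 // invr_ge0 subr_ge0 ler1n; lia.
have vc := nonincreasing_is_cvgn vd vb.
apply/cvg_ex; exists (limn v - 0); rewrite -(cvg_shiftn n).
have : v N - 8 * ((N + n)%:R - 1)^-1 @[N --> \oo] --> limn v - 0.
  apply: cvgB => //.
  by have := h0; rewrite -(cvg_shiftn n).
by apply: cvg_trans; apply: near_eq_cvg; near=> N; rewrite /v addrK.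
Unshelve. all: by end_near. Qed.

Lemma l1le_interp_lim n N : (9 <= n)%N -> (n <= N)%N ->
  l1le (interp_lim n - interp n N) (8 * (N%:R - 1)^-1).
Proof.
move=> n9 nN; apply: (@l1le_cvg _ (fun M => interp n M - interp n N)).
  by move=> k; apply: cvgB; [exact: cvg_interp|exact: cvg_cst].
near=> M; have NM : (N <= M)%N by near: M; exact: nbhs_infty_ge.
have [_ h] := l1le_interp_diff n9 nN; apply: (l1leW (h M NM)).
rewrite ler_wpM2l // gerBl invr_ge0 subr_ge0 ler1n; lia.
Unshelve. all: by end_near. Qed.

Lemma l1le_interp_lim_bound n : (9 <= n)%N -> l1le (interp_lim n) (8 * (n%:R - 1)^-1 + 2).
Proof.
move=> n9; rewrite -[interp_lim n](subrK (interp n n)); apply: l1leD.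
  exact: l1le_interp_lim.
by have [] := l1le_interp_diff n9 (leqnn n).
Qed.

Lemma cvg_pseries_lin (x y t : R) : pseries (fps_lin x y) t @ \oo --> x + y * t.
Proof.
rewrite -(cvg_shiftn 2).
have -> : (fun n => pseries (fps_lin x y) t (n + 2)%N) = (fun=> x + y * t); last exact: cvg_cst.
apply/funext => n; rewrite addn2 /pseries /series /= !big_nat_recl //= big1 ?addr0.
  by rewrite mulr1 expr1.
by move=> i _; rewrite mulr0n mul0r.
Qed.

Lemma cvg_pseries_bin_coef (t : R) n : `|t| < 1 ->
  pseries (bin_coef R n) t @ \oo --> bin_val (t / 2) n.
Proof.
move=> t1; elim: n => [|n IH] /=.
  rewrite bin_coef0 -fps_lin1; have := @cvg_pseries_lin 1 0 t.
  by rewrite mul0r addr0.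
rewrite bin_coefS [fps_lin _ _ * _]mulrC.
have -> : (n%:R + t / 2) / n.+1%:R = n%:R / n.+1%:R + 2^-1 / n.+1%:R * t by field; rewrite nat1r.
apply: (cvg_pseriesM t1 (@l1le_bin_coef R n) (l1le_lin _ _) IH).
exact: cvg_pseries_lin.
Qed.

Definition interp_val (n N : nat) (t : R) : R :=
  expR (ln (n%:R / N%:R) / 2 * (t - 1)) * expR (ln 2 / 2 * (t - 1)) *
  (bin_val (t / 2) N / bin_mass R N).

Lemma cvg_pseries_interp n N t : (0 < n <= N)%N -> `|t| < 1 ->
  pseries (interp n N) t @ \oo --> interp_val n N t.
Proof.
move=> /andP[n0 nN] t1.
have log_bnd : l1le (poisson (ln (n%:R / N%:R) / 2 : R)) (expR (2 * (ln (N%:R / n%:R) / 2) : R)).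
  have -> : ln (n%:R / N%:R) / 2 = - (ln (N%:R / n%:R) / 2) :> R.
    rewrite -mulNr -lnV ?invf_div // posrE divr_gt0 // ltr0n; lia.
  apply: l1le_poissonN; rewrite divr_ge0 // ln_ge0 // ler_pdivlMr ?ltr0n //.
  by rewrite mul1r ler_nat.
apply: cvg_pseriesM => //.
- apply: l1leM log_bnd _.
  by apply: l1le_poisson; rewrite divr_ge0 // ln_ge0 // ler1n.
- exact: l1le_bin_law.
- apply: cvg_pseriesM => //.
  + by apply: l1le_poisson; rewrite divr_ge0 // ln_ge0 // ler1n.
  + exact: cvg_pseries_poisson.
  + exact: cvg_pseries_poisson.
- have h : pseries (bin_coef R N) t m / bin_mass R N @[m --> \oo] --> bin_val (t / 2) N / bin_mass R N.
    by apply: cvgMr_tmp; exact: cvg_pseries_bin_coef.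
  apply: cvg_trans h; apply: near_eq_cvg; near=> m.
  rewrite /pseries /series /= mulr_suml; apply: eq_bigr => i _.
  by rewrite /bin_law fpsCM; ring.
Unshelve. all: by end_near. Qed.

(** Writing s / Gamma(1+s) for 1 / Gamma(s), and starting at [N.+1], keeps all arguments of Gamma
    positive for s > -1. *)
Lemma bin_val_Gamma (s : R) N : -1 < s ->
  bin_val s N.+1 = s * Gamma (N.+1%:R + s) / (Gamma (1 + s) * N.+1`!%:R).
Proof.
move=> s1; have g0 : 0 < Gamma (1 + s) by apply: Gamma_gt0; lra.
elim: N => [|N IH]; first by rewrite /= add0r mul1r divr1 mulr1 mulfK // gt_eqF.
rewrite /= -/(bin_val s N.+1) IH -[in RHS](natr1 N.+1) addrAC GammaS; last first.
  have : (1 : R) <= N.+1%:R by rewrite ler1n.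
  lra.
rewrite (factS N.+1) natrM; field.
by rewrite (gt_eqF g0) -natrD !pnatr_eq0 -lt0n fact_gt0.
Qed.

(** The Poisson rescaling supplies exactly the powers of N that normalise the two Gamma quotients of
    Gauss' formula, one for t and one for the mass at t = 1. *)
Lemma interp_val_u_gen n M (t : R) : (0 < n)%N -> -2 < t ->
  interp_val n M.+1 t = u_gen (ln (2 * n%:R) / 2) t *
    (Gamma (M.+1%:R + t / 2) / (M.+1%:R `^ (t / 2) * M`!%:R) /
     (Gamma (M.+1%:R + 2^-1) / (M.+1%:R `^ 2^-1 * M`!%:R))).
Proof.
move=> n0 t2; have n1 : (0 : R) < n%:R by rewrite ltr0n.
have N1 : (0 : R) < M.+1%:R by [].
have half : (0 : R) < 2^-1 by rewrite invr_gt0.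
rewrite /interp_val /bin_mass !bin_val_Gamma; [|lra|lra].
rewrite /u_gen (_ : 3 / 2 = 1 + 2^-1); last by field.
have g1 : 0 < Gamma (1 + t / 2) by apply: Gamma_gt0; lra.
have g2 : 0 < Gamma (1 + 2^-1 : R) by apply: Gamma_gt0; lra.
have M1 : (1 : R) <= M.+1%:R by rewrite ler1n.
have g3 : 0 < Gamma (M.+1%:R + t / 2) by apply: Gamma_gt0; lra.
have g4 : 0 < Gamma (M.+1%:R + 2^-1 : R) by apply: Gamma_gt0; lra.
have f0 : (0 : R) < M`!%:R by rewrite ltr0n fact_gt0.
have f1 : (0 : R) < M.+1`!%:R by rewrite ltr0n fact_gt0.
have p1 : 0 < M.+1%:R `^ (t / 2) by rewrite powR_gt0.
have p2 : (0 : R) < M.+1%:R `^ 2^-1 by rewrite powR_gt0.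
have -> : expR (ln (n%:R / M.+1%:R) / 2 * (t - 1)) * expR (ln 2 / 2 * (t - 1)) =
    expR (ln (2 * n%:R) / 2 * (t - 1)) * M.+1%:R `^ 2^-1 / M.+1%:R `^ (t / 2).
  rewrite /powR (gt_eqF N1) -expRN -!expRD; congr expR.
  by rewrite ln_div ?posrE // lnM ?posrE //; field.
move: (Gamma _) (Gamma _) (Gamma _) (Gamma _) g1 g2 g3 g4 => a b c d g1 g2 g3 g4.
by field; rewrite !gt_eqF.
Qed.

Lemma cvg_interp_val n (t : R) : (0 < n)%N -> `|t| < 1 ->
  interp_val n N t @[N --> \oo] --> u_gen (ln (2 * n%:R) / 2) t.
Proof.
move=> n0; rewrite ltr_norml => /andP[t1 t2].
rewrite -(cvg_shiftn 1).
have -> : (fun N => interp_val n (N + 1)%N t) = (fun M => u_gen (ln (2 * n%:R) / 2) t *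
    (Gamma (M.+1%:R + t / 2) / (M.+1%:R `^ (t / 2) * M`!%:R) /
     (Gamma (M.+1%:R + 2^-1) / (M.+1%:R `^ 2^-1 * M`!%:R)))).
  by apply/funext => M; rewrite addn1 interp_val_u_gen //; lra.
have e : u_gen (ln (2 * n%:R) / 2) t = u_gen (ln (2 * n%:R) / 2) t * (1 * 1^-1).
  by rewrite invr1 !mulr1.
rewrite [in X in _ --> X]e.
apply: cvgMl_tmp; apply: cvgM.
  by apply: Gamma_equiv; apply/andP; split; lra.
apply: cvgV; first exact: oner_neq0.
by apply: Gamma_equiv; apply/andP; split; lra.
Qed.

(** The values at t of [interp n N] tend to the left side by Gauss' formula, and to the right side
    because the norm controls values for |t| < 1. *)
Lemma u_gen_pseries n (t : R) : (9 <= n)%N -> `|t| < 1 ->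
  u_gen (ln (2 * n%:R) / 2) t = limn (pseries (interp_lim n) t).
Proof.
move=> n9 t1; have n0 : (0 < n)%N by lia.
pose v := limn (pseries (interp_lim n) t).
have bnd := l1le_interp_lim_bound n9.
have wv : pseries (interp_lim n) t @ \oo --> v by exact: is_cvg_l1le t1 bnd.
have key N : (n <= N)%N -> `|interp_val n N t - v| <= 8 * (N%:R - 1)^-1.
  move=> nN; have h := l1le_interp_lim n9 nN.
  have d : pseries (interp_lim n - interp n N) t @ \oo --> v - interp_val n N t.
    have h2 : (pseries (interp_lim n) t m - pseries (interp n N) t m) @[m --> \oo] --> v - interp_val n N t.
      by apply: cvgB => //; apply: cvg_pseries_interp => //; rewrite n0.
    apply: cvg_trans h2; apply: near_eq_cvg; near=> m.
    rewrite /pseries /series /= -sumrB; apply: eq_bigr => i _.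
    by rewrite fpsB mulrBl.
  (* With m = 0 the tail is the whole series, so its value is bounded by the norm. *)
  have := pseries_tail 0 (ltW t1) h d.
  by rewrite /pseries /series /= big_nil sub0r opprB expr0 mul1r.
have h0 := cvg_gap.
have h1 : (interp_val n N t - v) @[N --> \oo] --> (0 : R).
  apply/cvgr0Pnorm_lt => e e0; near=> N; apply: le_lt_trans (key N _) _.
    by near: N; exact: nbhs_infty_ge.
  apply: le_lt_trans (ler_norm _) _.
  by near: N; move/cvgr0Pnorm_lt : h0; apply.
have h2 : (interp_val n N t - v) @[N --> \oo] --> u_gen (ln (2 * n%:R) / 2) t - v.
  by apply: cvgB; [exact: cvg_interp_val|exact: cvg_cst].
apply/eqP; rewrite -subr_eq0 -/v; apply/eqP.
by rewrite -(cvg_lim _ h1) // (cvg_lim _ h2).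
Unshelve. all: by end_near. Qed.

Lemma u_coef_interp_lim n k : (9 <= n)%N ->
  u_coef (ln (2 * n%:R) / 2 : R) k = interp_lim n k.
Proof.
move=> n9; rewrite /u_coef.
have bnd := l1le_interp_lim_bound n9.
rewrite (@derive1n_pseries _ k (interp_lim n) (8 * (n%:R - 1)^-1 + 2) 1) //.
- by rewrite mulrC mulKf // pnatr_eq0 -lt0n fact_gt0.
- by move=> m; rewrite expr1n mulr1; exact: l1le_coef.
near=> t; apply: u_gen_pseries => //; near: t; exact: (@nbhs0_lt R R^o).
Unshelve. all: by end_near. Qed.

Lemma bin_law_u_coef n k : (9 <= n)%N ->
  `|(poisson (ln 2 / 2) * bin_law n) k - u_coef (ln (2 * n%:R) / 2 : R) k| <= 8 * (n%:R - 1)^-1.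
Proof.
move=> n9; rewrite u_coef_interp_lim // -interp_diag; last by lia.
rewrite distrC -fpsB; apply: l1le_coef; exact: l1le_interp_lim.
Qed.

End LimitLaw.

(** * The number of cycles *)

Section CycleCounts.
Variable R : realType.

Lemma weight_prod n (s : 'S_n) : weight R s = \prod_(c in porbits s) theta R #|c|.
Proof.
rewrite /weight.
rewrite [RHS](eq_bigr (fun c : {set 'I_n} => \prod_(1 <= j < n.+1 | #|c| == j) theta R j)); last first.
  move=> c /imsetP [x _ ->]; set c' := porbit s x.
  have c0 : (0 < #|c'|)%N by rewrite lt0n card_porbit_neq0.
  have cn : (#|c'| <= n)%N by rewrite -[n in X in (_ <= X)%N]card_ord max_card.
  rewrite (eq_bigl (fun j => j == #|c'|)) => [|j]; last exact: eq_sym.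
  by rewrite big_nat1_eq c0 ltnS cn.
rewrite (exchange_big_dep predT) //=; apply: eq_bigr => j _.
rewrite prodr_const; congr (_ ^+ _); rewrite /ncycles_len.
by apply: eq_card => c; rewrite !inE.
Qed.

Lemma porbits_setT (T : finType) (s : {perm T}) : (porbit s @: [set: T])%SET = porbits s.
Proof. by apply/setP => c; apply/imsetP/imsetP => -[x _ ->]; exists x. Qed.

Lemma Theta_coefS j : j.+1%:R * Theta R j.+1 = theta R j.+1.
Proof.
rewrite /Theta fpsD /= /kappa; field; rewrite nat1r pnatr_eq0 //.
Qed.

Lemma Theta_coef0 : Theta R 0%N = 0.
Proof. by rewrite /Theta fpsD /= addr0. Qed.

(** [cyc_coef n] has degree at most n in t; as a polynomial it can also be evaluated at t = 1, which
    gives the denominator of [q_cycles]. *)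
Definition cyc_poly (n : nat) : {poly R} := \poly_(k < n.+1) cyc_coef R n k.

Lemma coef_cyc_poly n k : (cyc_poly n)`_k = cyc_coef R n k.
Proof.
rewrite coef_poly; case: ltnP => // nk.
by rewrite /cyc_coef expc_lt // Theta_coef0.
Qed.

Lemma cyc_polyS n : n.+1%:R * cyc_poly n.+1 =
  \sum_(i < n.+1) (theta R i.+1)%:P * 'X * cyc_poly (n - i)%N.
Proof.
apply/polyP => k; rewrite coef_sum -[n.+1%:R]polyC_natr coefCM coef_cyc_poly.
case: k => [|k].
  rewrite /cyc_coef expc_coef0 mulr0 big1 // => i _.
  by rewrite -mulrA coefCM coefXM mulr0.
rewrite /cyc_coef expc_rec; apply: eq_bigr => i _.
by rewrite Theta_coefS -[in RHS]mulrA coefCM coefXM coef_cyc_poly.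
Qed.

Lemma sum_weight_poly n :
  \sum_(s : 'S_n) (weight R s)%:P * 'X^(ncycles s) = n`!%:R * cyc_poly n.
Proof.
have H0 : cyc_poly 0 = 1.
  apply/polyP => k; rewrite coef_cyc_poly coef1.
  by rewrite /cyc_coef expc0 ?Theta_coef0 // fps1.
have := @cyc_sum_eq _ 'I_n (fun j => (theta R j)%:P * 'X) cyc_poly H0 cyc_polyS finset.setT.
rewrite cardsT card_ord => <-; rewrite /cyc_sum; apply: eq_big => [s|s _].
  by apply/esym/fintype.subsetP => x _; rewrite inE.
rewrite /cyc_weight porbits_setT big_split /= prodr_const weight_prod rmorph_prod //.
Qed.

Definition cyc_mass (n : nat) : R := \sum_(k < n.+1) cyc_coef R n k.

Lemma q_cycles_coef n k : q_cycles R n k = cyc_coef R n k / cyc_mass n.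
Proof.
have f0 : n`!%:R != 0 :> R by rewrite pnatr_eq0 -lt0n fact_gt0.
have num : \sum_(s in [set s : 'S_n | ncycles s == k]%SET) weight R s = n`!%:R * cyc_coef R n k.
  have := congr1 (fun p : {poly R} => p`_k) (sum_weight_poly n).
  rewrite -[n`!%:R]polyC_natr coefCM coef_cyc_poly => <-.
  rewrite coef_sum [RHS](bigID (fun s : 'S_n => ncycles s == k)) /= [X in _ + X]big1 ?addr0.
    apply: eq_big => [s|s]; rewrite ?inE //.
    by move=> /eqP <-; rewrite coefCM coefXn eqxx mulr1.
  by move=> s /negbTE sk; rewrite coefCM coefXn eq_sym sk mulr0.
have den : \sum_(s : 'S_n) weight R s = n`!%:R * cyc_mass n.
  have := congr1 (fun p : {poly R} => p.[1]) (sum_weight_poly n).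
  rewrite horner_sum -[n`!%:R]polyC_natr hornerCM.
  rewrite /cyc_poly horner_poly => e; rewrite [LHS](eq_bigr (fun s : 'S_n => ((weight R s)%:P * 'X^(ncycles s)).[1])).
    by rewrite e; congr (_ * _); apply: eq_bigr => i _; rewrite expr1n mulr1.
  by move=> s _; rewrite hornerCM hornerXn expr1n mulr1.
by rewrite /q_cycles /prob_perm num den -mulf_div divff // mul1r.
Qed.

Lemma cyc_coef_ge0 n k : 0 <= cyc_coef R n k.
Proof.
have T0 j : 0 <= Theta R j.
  rewrite /Theta fpsD addr_ge0 ?Kap_ge0 //; case: j => //= j.
rewrite divr_ge0 //; elim: k n => [|k IH] n; first by rewrite expr0 fps1.
by rewrite exprS fpsM sumr_ge0 // => j _; rewrite mulr_ge0.
Qed.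

Lemma cyc_coef_le_mass n k : cyc_coef R n k <= cyc_mass n.
Proof.
have [kn|nk] := ltnP k n.+1; last first.
  rewrite {1}/cyc_coef expc_lt ?Theta_coef0 // sumr_ge0 // => i _; exact: cyc_coef_ge0.
rewrite /cyc_mass (bigD1 (Ordinal kn)) //= lerDl sumr_ge0 // => i _; exact: cyc_coef_ge0.
Qed.

Lemma cvg_series_lin (x y : R) (b : fps R) (l : R) : series b @ \oo --> l ->
  series (fps_lin x y * b) @ \oo --> (x + y) * l.
Proof.
move=> bl; rewrite -(cvg_shiftn 1).
have -> : (fun n => series (fps_lin x y * b) (n + 1)%N) =
    (fun n => x * series b (n + 1)%N + y * series b n).
  apply/funext => n; rewrite addn1 /series /=; elim: n => [|n IH].
    by rewrite !big_nat1 big_nil mulr0 addr0 fps_lin_coef0.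
  rewrite big_nat_recr //= IH fps_lin_coefS.
  by rewrite !(big_nat_recr _ _ b) //=; ring.
by rewrite mulrDl; apply: cvgD; apply: cvgMl_tmp => //; rewrite (cvg_shiftn 1).
Qed.

(** The main term at t = 1. It lets [cyc_mass_approx] deduce the estimate of the normalising
    constant from the one of the coefficients, at the same precision. *)
Lemma cvg_series_main n :
  series (fpsC (sqrt2 R) * poisson (ln 2 / 2) * bin_coef R n) @ \oo --> sqrt2 R * bin_mass R n.
Proof.
elim: n => [|n IH].
  rewrite bin_coef0 mulr1 /bin_mass /=.
  have h : sqrt2 R * series (poisson (ln 2 / 2)) N @[N --> \oo] --> sqrt2 R * 1.
    by apply: cvgMl_tmp; exact: cvg_series_poisson.
  apply: cvg_trans h; apply: near_eq_cvg; near=> N; rewrite /series /= mulr_sumr.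
  by apply: eq_bigr => k _; rewrite fpsCM.
rewrite bin_coefS mulrCA bin_massS_lin [sqrt2 R * _]mulrCA.
exact: cvg_series_lin.
Unshelve. all: by end_near. Qed.

Lemma cyc_mass_approx n :
  `|cyc_mass n - sqrt2 R * bin_mass R n| <= 42 * expR 2 * (bin_mass R n / n.+1%:R).
Proof.
have h1 : series (cyc_coef R n) N @[N --> \oo] --> cyc_mass n.
  rewrite -(cvg_shiftn n.+1).
  have -> : (fun N => series (cyc_coef R n) (N + n.+1)%N) = (fun=> cyc_mass n); last exact: cvg_cst.
  apply/funext => N; rewrite /series /= (@big_cat_nat _ _ _ n.+1) //= ?leq_addl //.
  rewrite big_mkord [X in _ + X]big_nat [X in _ + X]big1 ?addr0 // => k /andP[nk _].
  by rewrite /cyc_coef expc_lt // Theta_coef0.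
have h : `|series (cyc_coef R n) N - series (fpsC (sqrt2 R) * poisson (ln 2 / 2) * bin_coef R n) N| @[N --> \oo] -->
    `|cyc_mass n - sqrt2 R * bin_mass R n|.
  by apply: cvg_norm; apply: cvgB => //; exact: cvg_series_main.
rewrite -(cvg_lim _ h) //; apply: limr_le; first by apply/cvg_ex; eexists; exact: h.
near=> N; apply: le_trans (@cyc_coef_approx R n N).
rewrite /series /= -sumrB; exact: ler_norm_sum.
Unshelve. all: by end_near. Qed.

End CycleCounts.

Theorem corollary1p9 (R : realType) :
  exists C : R, \forall n \near \oo, forall k : nat, (1 <= k)%N ->
    `|q_cycles R n k - u_coef (ln (2 * n%:R) / 2 : R) k| <= C / n%:R.
Proof.
(* The constant of [cyc_coef_approx]. It enters twice, through the numerator and the denominator of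
   q; the 16 comes from 8/(n-1) <= 16/n. *)
pose C : R := 42 * expR 2.
have C0 : 0 < C by rewrite mulr_gt0 ?expR_gt0.
exists (2 * C + 16); near=> n => k _.
have n9 : (9 <= n)%N by near: n; exact: nbhs_infty_ge.
(* This makes the error of the total mass smaller than its main term, so that [Z] is positive. *)
have nC : C < n%:R by near: n; exact: nbhs_infty_gtr.
have n0 : (9 : R) <= n%:R by rewrite ler_nat.
set s := bin_mass R n; set r := sqrt2 R; set Z := cyc_mass R n; set h := cyc_coef R n k.
have s0 : 0 < s by exact: bin_mass_gt0.
have r1 : 1 <= r by rewrite -[leLHS]expR0 ler_expR divr_ge0 // ln_ge0 // ler1n.
have rs0 : 0 < r * s by rewrite mulr_gt0 //; lra.
have eps : C * (s / n.+1%:R) <= C / n%:R * s.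
  rewrite mulrA mulrAC ler_pM2r // ler_pM2l // lef_pV2 ?posrE ?ltr0n //; last by lia.
  by rewrite ler_nat.
have hZ : `|Z - r * s| <= C / n%:R * s by apply: le_trans eps; exact: cyc_mass_approx.
have Z0 : 0 < Z.
  have : C / n%:R * s < r * s by rewrite ltr_pM2r // (lt_le_trans _ r1) // ltr_pdivrMr ?mul1r //; lra.
  move: hZ; rewrite ler_norml => /andP[h1 _]; lra.
have h0 : 0 <= h by exact: cyc_coef_ge0.
have hle : h <= Z by exact: cyc_coef_le_mass.
pose a := (poisson (ln 2 / 2) * bin_law R n) k.
have ha : `|h - r * s * a| <= C / n%:R * s.
  apply: le_trans eps; have := l1le_coef k (@cyc_coef_approx R n).
  rewrite fpsB (_ : (fpsC _ * _ * _) k = r * s * a) //.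
  rewrite /a /bin_law -mulrA !(mulrCA (poisson _) (fpsC _)) !fpsCM -/s -/r.
  by field; rewrite gt_eqF.
have da := bin_law_u_coef R k n9; rewrite -/a in da.
rewrite q_cycles_coef -/h -/Z.
have e1 : `|h / Z - a| <= 2 * C / n%:R.
  (* In this splitting the error of [Z] is multiplied by h / Z <= 1, and the only division left is
     by the explicit main term r * s. *)
  have -> : h / Z - a = (h / Z * (r * s - Z) + (h - r * s * a)) / (r * s).
    by field; rewrite !gt_eqF //; lra.
  rewrite normrM normfV (gtr0_norm rs0) ler_pdivrMr //.
  apply: le_trans (ler_normD _ _) _; rewrite normrM.
  have q0 : 0 <= h / Z by rewrite divr_ge0 // ltW.
  have q1 : `|h / Z| <= 1 by rewrite (ger0_norm q0) ler_pdivrMr // mul1r.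
  have q2 : `|h / Z| * `|r * s - Z| <= C / n%:R * s.
    by rewrite distrC; apply: le_trans hZ; rewrite ler_piMl.
  have q3 : C / n%:R * s <= C / n%:R * (r * s).
    have cn : 0 < C / n%:R by rewrite divr_gt0 //; lra.
    by rewrite ler_pM2l // ler_peMl // ltW.
  have -> : 2 * C / n%:R * (r * s) = C / n%:R * (r * s) + C / n%:R * (r * s) by ring.
  lra.
have e2 : 8 * (n%:R - 1)^-1 <= 16 / n%:R :> R.
  rewrite ler_pdivlMr; last by lra.
  by rewrite mulrAC ler_pdivrMr; lra.
have -> : h / Z - u_coef (ln (2 * n%:R) / 2) k = (h / Z - a) + (a - u_coef (ln (2 * n%:R) / 2) k).
  by rewrite addrA subrK.
by apply: le_trans (ler_normD _ _) _; rewrite [leRHS]mulrDl; apply: lerD e1 (le_trans da e2).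
Unshelve. all: by end_near. Qed.
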